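(* Let $\Omega=(a,b)\subset\mathbb{R}$ be a bounded open interval, $f\in BV(\Omega)$ and $w\in L^\infty(\Omega)$ with $w\ge0$. If $u$ is a solution of $$\min_{u\in BV(\Omega)}\ \frac12\int_\Omega w(f-u)^2\,dx+|Du|(\Omega),$$ then $$J_u\cap\mathrm{supp}_{l,r}w\subseteq J_f,$$ where $$\mathrm{supp}_{l,r}w=\{x\in\Omega:\ \text{for every }\epsilon>0,\ w\text{ is not zero a.e. in each of the sets }(x-\epsilon,x)\text{ and }(x,x+\epsilon)\}.$$ In particular, if $w>0$ a.e., then $J_u\subseteq J_f$.
   Context: For $u\in BV(\Omega)$, $Du$ denotes its distributional derivative (a finite Radon measure), $|Du|$ its total variation measure, and $J_u=\{x\in\Omega:\ |Du|(\{x\})\neq0\}$ its jump set. Solutions of the minimisation problem exist but need not be unique. *)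

(* Defs.v *)
From HB Require Import structures.
From mathcomp Require Import all_boot all_order all_algebra.
From mathcomp Require Import all_classical all_reals all_analysis.

Set Implicit Arguments.
Unset Strict Implicit.
Unset Printing Implicit Defensive.

Import Order.TTheory GRing.Theory Num.Theory.
Import numFieldNormedType.Exports.

Local Open Scope ring_scope.
Local Open Scope classical_set_scope.

(* Finite signed measures. The library's Jordan decomposition is relative to a
   given Hahn decomposition; one is chosen here. The measures obtained do not
   depend on the choice. *)
Section signed_measure.
Context {d : measure_display} {T : measurableType d} {R : realType}.
Implicit Type nu : {charge set T -> \bar R}.

Definition hahnP nu : set T := sval (cid (Hahn_decomposition nu)).

Definition hahnN nu : set T := sval (cid (svalP (cid (Hahn_decomposition nu)))).

Definition hahnPN nu : hahn_decomposition nu (hahnP nu) (hahnN nu) :=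
  svalP (cid (svalP (cid (Hahn_decomposition nu)))).

Definition total_var nu : set T -> \bar R := charge_variation (hahnPN nu).

Definition charge_integral nu (D : set T) (g : T -> \bar R) : \bar R :=
  (\int[jordan_pos (hahnPN nu)]_(x in D) g x
   - \int[jordan_neg (hahnPN nu)]_(x in D) g x)%E.

End signed_measure.

Section bounded_variation.
Context {R : realType}.
Notation mu := (@lebesgue_measure R).
Implicit Types (Omega : set R) (f u v w phi : R -> R).
Implicit Type nu : {charge set (measurableTypeR R) -> \bar R}.

(* C_c^oo(Omega), each function being extended by zero to R. *)
Definition test_function Omega phi : Prop :=
  [/\ forall (n : nat) (x : R), derivable (phi^`(n)) x 1,
      compact (closure [set x | phi x != 0]) &
      closure [set x | phi x != 0] `<=` Omega].

(* A finite Radon measure on Omega is a charge on the Borel sets of R that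
   vanishes off Omega. On R every finite Borel measure is Radon. *)
Definition is_distr_deriv Omega u nu : Prop :=
  (forall A, measurable A -> A `&` Omega = set0 -> nu A = 0%E) /\
  forall phi, test_function Omega phi ->
    (\int[mu]_(x in Omega) (u x * derive1 phi x)%:E
     = - charge_integral nu Omega (EFin \o phi))%E.

(* Elements of L^1 are represented by functions that are Borel measurable on
   Omega; their values off Omega are irrelevant, and Borel functions that agree
   almost everywhere on Omega have the same distributional derivatives. *)
Definition bv Omega u : Prop :=
  mu.-integrable Omega (EFin \o u) /\ exists nu, is_distr_deriv Omega u nu.

(* The null charge is a default value, used only when u has no finite
   distributional derivative. *)
Definition distr_deriv Omega u : {charge set (measurableTypeR R) -> \bar R} :=
  if pselect (exists nu, is_distr_deriv Omega u nu) is left h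
  then sval (cid h) else czero.

Definition jump_set Omega u : set R :=
  [set x | Omega x /\ total_var (distr_deriv Omega u) [set x] <> 0%E].

Definition energy Omega f w u : \bar R :=
  ((2^-1)%:E * \int[mu]_(x in Omega) (w x * (f x - u x) ^+ 2)%:E
   + total_var (distr_deriv Omega u) Omega)%E.

Definition is_solution Omega f w u : Prop :=
  bv Omega u /\
  forall v, bv Omega v -> (energy Omega f w u <= energy Omega f w v)%E.

(* w is only given on Omega, hence the intersections with Omega. *)
Definition supp_lr Omega w : set R :=
  [set x | Omega x /\ forall e : R, 0 < e ->
     ~ {ae mu, forall y, (`]x - e, x[ `&` Omega) y -> w y = 0} /\
     ~ {ae mu, forall y, (`]x, x + e[ `&` Omega) y -> w y = 0}].

End bounded_variation.

(* Main.v *)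
Require Import Defs.
From mathcomp Require Import all_boot all_order all_algebra.
From mathcomp Require Import all_classical all_reals all_analysis.
From mathcomp Require Import measurable_realfun ess_sup_inf ring lra.
Import Order.TTheory GRing.Theory Num.Theory.
Import numFieldNormedType.Exports.
Local Open Scope ring_scope.
Local Open Scope classical_set_scope.

(** If [Du] has an atom [c <> 0] at [x0] and [Df] has none, then [f - u] jumps by
    [-c] at [x0]. So, on a small interval at the left of [x0], [f - u] has the
    sign of [c] and is bounded away from zero, or else it has the opposite sign
    on a small interval at the right. Moving [u] on that interval towards [f] by a
    small constant moves a part of the atom from [x0] to the other end of
    the interval, which does not increase the total variation, but it strictly
    decreases the fidelity term unless [w] vanishes a.e. on the interval.

    The one-sided behaviour of a BV function [v] is read off the formula
    [v y - v x = Dv ]x, y[], valid at all Lebesgue points [x < y]. It is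
    obtained by testing [Dv] against smooth functions that converge to
    [\1_(]x, y[)] and whose derivatives are differences of approximate identities
    at [x] and [y]. The same test functions show that [Dv] is unique. *)

(** * Smooth ramps and plateaus *)

(** The powers of [1/x] are carried along so that the family is closed under derivation up to linear
    combinations; [k = 0] is the classical function that is flat at 0. *)
Definition flat {R : realType} (k : nat) (x : R) : R :=
  if 0 < x then x^-1 ^+ k * expR (- x^-1) else 0.

Lemma flat_ge0 (R : realType) k (x : R) : 0 <= flat k x.
Proof.
rewrite /flat; case: ifPn => // x0.
by rewrite mulr_ge0 ?expR_ge0// exprn_ge0// invr_ge0 ltW.
Qed.

Lemma flat_eq0 (R : realType) k (x : R) : x <= 0 -> flat k x = 0.
Proof. by rewrite /flat leNgt => /negbTE ->. Qed.

Lemma flat_gt0 (R : realType) k (x : R) : 0 < x -> 0 < flat k x.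
Proof. by move=> x0; rewrite /flat x0 mulr_gt0 ?expR_gt0// exprn_gt0// invr_gt0. Qed.

(** For [0 < x], the exponential of [1/x] dominates the term of degree [k + 2] of its power series.
    The bound serves to show that every [flat k] tends to 0 at 0. *)
Lemma flat_le_sqr (R : realType) k (x : R) : flat k x <= (k.+2)`!%:R * x ^+ 2.
Proof.
rewrite /flat; case: ifPn => x0; last by rewrite mulr_ge0// sqr_ge0.
have f0 : 0 < (k.+2)`!%:R :> R by rewrite ltr0n fact_gt0.
rewrite expRN ler_pdivrMr ?expR_gt0//.
have yx : x * x^-1 = 1 by rewrite mulfV// gt_eqF.
have -> : x^-1 ^+ k = (k.+2)`!%:R * x ^+ 2 * (x^-1 ^+ k.+2 / (k.+2)`!%:R).
  rewrite -[X in _ * (x^-1 ^+ X / _)]addn2 exprD; move: yx; set y := x^-1 => yx.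
  have e : x ^+ 2 * y ^+ 2 = 1 by rewrite -exprMn yx expr1n.
  rewrite -[LHS]mulr1 -e; field.
  by rewrite !gt_eqF ?invr_gt0.
apply: ler_wpM2l; first by rewrite mulr_ge0 ?sqr_ge0// ltW.
apply: le_trans (expR_ge1Dxn k.+1 _); last by rewrite invr_ge0 ltW.
by rewrite lerDr.
Qed.

Lemma is_derive_flat (R : realType) k (x : R) :
  is_derive x 1 (flat k) (flat k.+2 x - k%:R * flat k.+1 x).
Proof.
have [x0|x0|->] := ltgtP x 0.
- rewrite !flat_eq0 ?ltW// mulr0 subr0.
  apply: (@near_eq_is_derive _ _ _ (cst 0)).
  near=> y; rewrite flat_eq0// ltW//; near: y; exact: lt_nbhsl.
- have xn : x != 0 by rewrite gt_eqF.
  have d1 : is_derive x 1 (fun y : R => y^-1) (- x ^- 2).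
    have := @is_deriveV R id x 1 1 xn (is_derive_id _ _).
    by rewrite /GRing.scale /= mulr1.
  have E : is_derive x 1 (fun y : R => (y^-1) ^+ k * expR (- y^-1))
     (flat k.+2 x - k%:R * flat k.+1 x).
    have -> : (fun y : R => y^-1 ^+ k * expR (- y^-1)) =
        (fun y : R => y^-1) ^+ k * (expR \o (- (fun y : R => y^-1))).
      by apply/funext => y; rewrite !fctE.
    apply: is_derive_eq.
    rewrite !fctE /flat x0 /GRing.scale /=; move: (expR _) => E.
    rewrite -exprVn; move: x^-1 => y.
    by case: k => [|k] /=; rewrite ?mulr0n ?exprS; ring.
  apply: near_eq_is_derive E.
  near=> y; rewrite /flat ifT//; near: y; exact: lt_nbhsr.
(* At 0 the slope function of [flat k] is [flat k.+1], and its continuity at 0 follows from the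
   quadratic bound. *)
- rewrite !flat_eq0// mulr0 subr0; apply/is_derive1_caratheodory.
  exists (flat k.+1); split.
  + move=> z; rewrite (@flat_eq0 _ _ 0)// !subr0 /flat; case: ifPn => z0.
      by rewrite exprSr mulrAC -(mulrA _ z^-1) mulVf ?gt_eqF// mulr1.
    by rewrite mul0r.
  + rewrite /prop_for /continuous_at (@flat_eq0 _ _ 0)//.
    apply: (@squeeze_cvgr _ _ _ _ (cst 0) (fun z : R => (k.+3)`!%:R * z ^+ 2)).
    * by near=> z; rewrite flat_ge0 flat_le_sqr.
    * exact: cvg_cst.
    * rewrite -[X in _ --> X](mulr0 ((k.+3)`!%:R : R)).
      apply: cvgM; first exact: cvg_cst.
      by rewrite -[X in _ --> X](expr0n _ 2); exact: exprn_continuous.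
  + exact: flat_eq0.
Unshelve. all: by end_near. Qed.

(* Any class of functions that is closed under derivation consists of infinitely
   differentiable functions; this one contains the ramp below. *)
Inductive smooth {R : realType} : (R -> R) -> Prop :=
| smooth_cst (c : R) : smooth (cst c)
| smooth_flat (k : nat) (c d : R) : smooth (fun x => flat k (c * x + d))
| smoothD f g : smooth f -> smooth g -> smooth (f \+ g)
| smoothM f g : smooth f -> smooth g -> smooth (f \* g)
| smoothV f : (forall x, f x != 0) -> smooth f -> smooth (fun x => (f x)^-1).

Lemma derivable_continuous (R : realType) (f : R -> R) :
  (forall x, derivable f x 1) -> continuous f.
Proof.
by move=> df x; apply: differentiable_continuous; exact/derivable1_diffP.
Qed.

Lemma is_derive_affine (R : realType) (c d x : R) :
  is_derive x 1 (fun y : R => c * y + d) c.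
Proof.
have -> : (fun y : R => c * y + d) = (fun y => c *: y) + cst d by [].
by apply: is_derive_eq; rewrite addr0 /GRing.scale /= mulr1.
Qed.

(** The derivative is produced inside the class, so that derivation can be iterated. *)
Lemma smooth_derive (R : realType) (f : R -> R) : smooth f ->
  exists2 g : R -> R, smooth g & forall x : R, is_derive x 1 f (g x).
Proof.
elim=> {f} [c|k c d|f g sf [f' sf' df] sg [g' sg' dg]
  |f g sf [f' sf' df] sg [g' sg' dg]|f f0 sf [f' sf' df]].
- by exists (cst 0); [exact: smooth_cst|move=> x; exact: is_derive_cst].
- exists ((fun x => flat k.+2 (c * x + d)) \* cst c \+
    (fun x => flat k.+1 (c * x + d)) \* cst (- (k%:R * c))).
    by apply: smoothD; apply: smoothM; (exact: smooth_flat || exact: smooth_cst).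
  move=> x.
  have := @is_derive1_comp R _ (fun y => c * y + d) x _ _
    (is_derive_flat R k (c * x + d)) (is_derive_affine R c d x).
  by move=> h; apply: (is_derive_eq h) => /=; ring.
- by exists (f' \+ g'); [exact: smoothD|move=> x; exact: is_deriveD].
- exists (f \* g' \+ g \* f'); first by apply: smoothD; exact: smoothM.
  by move=> x; exact: is_deriveM.
- exists ((fun x => (f x)^-1) \* (fun x => (f x)^-1) \* f' \* cst (- 1)).
    by repeat apply: smoothM => //; (exact: smoothV || exact: smooth_cst).
  move=> x; apply: (is_derive_eq (@is_deriveV R f x _ _ (f0 x) (df x))).
  by rewrite /GRing.scale/= -exprVn; ring.
Qed.

Lemma smooth_derive1 (R : realType) (f : R -> R) : smooth f -> smooth f^`().
Proof.
move=> /smooth_derive[g sg dg].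
by rewrite (_ : f^`() = g)//; apply/funext => x; rewrite derive1E derive_val.
Qed.

Lemma smooth_derivable (R : realType) (f : R -> R) : smooth f ->
  forall x, derivable f x 1.
Proof. by move=> /smooth_derive[g _ dg] x; have [] := dg x. Qed.

Lemma smooth_continuous (R : realType) (f : R -> R) : smooth f -> continuous f.
Proof.
by move=> sf; apply: derivable_continuous; exact: smooth_derivable.
Qed.

Lemma smooth_derive1n (R : realType) (f : R -> R) n : smooth f -> smooth f^`(n).
Proof.
by move=> sf; elim: n => [//|n ih]; rewrite derive1nS; exact: smooth_derive1.
Qed.

(** The usual smooth transition from 0 to 1 on the unit interval. The denominator never vanishes,
    since [x] or [1 - x] is positive. *)
Definition ramp {R : realType} (x : R) : R :=
  flat 0 x / (flat 0 x + flat 0 (1 - x)).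

Lemma ramp_den_gt0 (R : realType) (x : R) : 0 < flat 0 x + flat 0 (1 - x).
Proof.
have [x0|x0] := ltP 0 x; first by rewrite ltr_pwDl ?flat_gt0// flat_ge0.
by rewrite ltr_wpDl ?flat_ge0// flat_gt0// subr_gt0 (le_lt_trans x0).
Qed.

Lemma smooth_ramp_affine (R : realType) (c d : R) :
  smooth (fun x => ramp (c * x + d)).
Proof.
apply: (@smoothM R (fun x => flat 0 (c * x + d))
  (fun x => (flat 0 (c * x + d) + flat 0 (1 - (c * x + d)))^-1)).
  exact: smooth_flat.
apply: (@smoothV R (fun x => flat 0 (c * x + d) + flat 0 (1 - (c * x + d)))).
  by move=> x; rewrite gt_eqF// ramp_den_gt0.
apply: (@smoothD R (fun x => flat 0 (c * x + d)) (fun x => flat 0 (1 - (c * x + d)))).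
  exact: smooth_flat.
rewrite (_ : (fun x => _) = fun x => flat 0 (- c * x + (1 - d))).
  exact: smooth_flat.
by apply/funext => x; congr flat; ring.
Qed.

Lemma smooth_ramp (R : realType) : smooth (@ramp R).
Proof.
rewrite (_ : ramp = fun x : R => ramp (1 * x + 0)); first exact: smooth_ramp_affine.
by apply/funext => x; rewrite mul1r addr0.
Qed.

Lemma ramp0 (R : realType) (x : R) : x <= 0 -> ramp x = 0.
Proof. by move=> x0; rewrite /ramp flat_eq0// mul0r. Qed.

Lemma ramp1 (R : realType) (x : R) : 1 <= x -> ramp x = 1.
Proof.
move=> x1; rewrite /ramp (@flat_eq0 _ _ (1 - x)) ?subr_le0// addr0 divff//.
by rewrite gt_eqF// flat_gt0// (lt_le_trans _ x1).
Qed.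

Lemma ramp_itv (R : realType) (x : R) : 0 <= ramp x <= 1.
Proof.
have d0 := ramp_den_gt0 R x; apply/andP; split.
  by rewrite divr_ge0 ?flat_ge0// ltW.
by rewrite /ramp ler_pdivrMr// mul1r lerDl flat_ge0.
Qed.

Lemma derive1_ramp_eq0 (R : realType) (x : R) : (x < 0) || (1 < x) -> ramp^`() x = 0.
Proof.
move=> /orP[x0|x1]; rewrite derive1E.
- rewrite (@near_eq_derive _ R R _ (cst 0)) ?derive_cst//.
  by near=> y; rewrite ramp0// ltW//; near: y; exact: lt_nbhsl.
- rewrite (@near_eq_derive _ R R _ (cst 1)) ?derive_cst//.
  by near=> y; rewrite ramp1// ltW//; near: y; exact: lt_nbhsr.
Unshelve. all: by end_near. Qed.

(** The derivative is continuous on the compact [[0, 1]] and zero outside it. After rescaling, this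
    bounds the kernels by [C / h]. *)
Lemma derive1_ramp_bounded (R : realType) :
  exists2 C : R, 0 < C & forall x : R, `|ramp^`() x| <= C.
Proof.
have ck : continuous (ramp^`() : R -> R).
  by apply: smooth_continuous; apply: smooth_derive1; exact: smooth_ramp.
have [M [_ /= hM]] := @compact_bounded R R^o _
  (continuous_compact (continuous_subspaceT ck) (@segment_compact R 0 1)).
exists (`|M| + 1) => [|x]; first by rewrite ltr_pwDr.
have [/andP[x0 x1]|] := boolP ((0 <= x) && (x <= 1)).
  by apply: hM; [rewrite ltr_pwDr ?ler_norm|exists x => //=; rewrite in_itv/= x0].
by rewrite negb_and -!ltNge => /derive1_ramp_eq0 ->; rewrite normr0 addr_ge0.
Qed.

(** The derivative of the rescaled ramp: an approximate identity of mass 1 at scale [h], supported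
    in [[- h d, h (1 - d)]]. *)
Definition ramp_kernel {R : realType} (h d s : R) : R :=
  h^-1 * derive1 ramp (h^-1 * s + d).

Lemma derive1_ramp_affine (R : realType) (h d : R) :
  derive1 (fun s => ramp (h^-1 * s + d)) = ramp_kernel h d.
Proof.
apply/funext => s.
have d1 : is_derive (h^-1 * s + d) 1 ramp (derive1 ramp (h^-1 * s + d)).
  by rewrite derive1E; apply: derivableP; exact: smooth_derivable (smooth_ramp R) _.
have := @is_derive1_comp R _ (fun s => h^-1 * s + d) s _ _ d1
  (is_derive_affine R h^-1 d s).
by move=> [_ h1]; rewrite derive1E -[RHS]mulrC -h1.
Qed.

Lemma smooth_ramp_kernel (R : realType) (h d : R) : smooth (ramp_kernel h d).
Proof.
by rewrite -derive1_ramp_affine; apply: smooth_derive1; exact: smooth_ramp_affine.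
Qed.

(* For [0 < h] and [4 * h <= y - x], it increases from 0 to 1 on [x + h, x + 2h] and
   decreases to 0 on [y - 2h, y - h], so that its support is in the open interval
   ]x, y[ even when [x] or [y] is an end point of the domain. *)
Definition plateau {R : realType} (x y h s : R) : R :=
  ramp (h^-1 * s + (- (h^-1 * x) - 1)) - ramp (h^-1 * s + (2 - h^-1 * y)).

Section plateau.
Context {R : realType}.
Implicit Types x y h s a b : R.

Lemma smooth_plateau x y h : smooth (plateau x y h).
Proof.
rewrite (_ : plateau x y h =
  (fun s => ramp (h^-1 * s + (- (h^-1 * x) - 1))) \+
  cst (- 1) \* (fun s => ramp (h^-1 * s + (2 - h^-1 * y)))); last first.
  by apply/funext => s; rewrite /plateau /= mulN1r.
apply: smoothD; first exact: smooth_ramp_affine.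
apply: smoothM; first exact: smooth_cst.
exact: smooth_ramp_affine.
Qed.

Lemma derive1_plateau x y h s : derive1 (plateau x y h) s =
  ramp_kernel h (- (h^-1 * x) - 1) s - ramp_kernel h (2 - h^-1 * y) s.
Proof.
have D d : is_derive s 1 (fun s => ramp (h^-1 * s + d)) (ramp_kernel h d s).
  rewrite -derive1_ramp_affine derive1E; apply: derivableP.
  exact: smooth_derivable (smooth_ramp_affine _ _ _) _.
by rewrite derive1E; apply: derive_val.
Qed.

Lemma plateauE x y h s :
  plateau x y h s = ramp ((s - x) / h - 1) - ramp ((s - y) / h + 2).
Proof. by rewrite /plateau; congr (ramp _ - ramp _); ring. Qed.

Lemma plateau_left x y h s : 0 < h -> s <= x + h -> s <= y - 2 * h ->
  plateau x y h s = 0.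
Proof.
move=> h0 s1 s2; have p1 : (s - x) / h <= 1 by rewrite ler_pdivrMr//; lra.
have p2 : (s - y) / h <= - 2 by rewrite ler_pdivrMr//; lra.
by rewrite plateauE (@ramp0 _ (_ - 1)) ?(@ramp0 _ (_ + 2)) ?subrr//; lra.
Qed.

Lemma plateau_right x y h s : 0 < h -> x + 2 * h <= s -> y - h <= s ->
  plateau x y h s = 0.
Proof.
move=> h0 s1 s2; have p1 : 2 <= (s - x) / h by rewrite ler_pdivlMr//; lra.
have p2 : - 1 <= (s - y) / h by rewrite ler_pdivlMr//; lra.
by rewrite plateauE (@ramp1 _ (_ - 1)) ?(@ramp1 _ (_ + 2)) ?subrr//; lra.
Qed.

Lemma plateau_middle x y h s : 0 < h -> x + 2 * h <= s -> s <= y - 2 * h ->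
  plateau x y h s = 1.
Proof.
move=> h0 s1 s2; have p1 : 2 <= (s - x) / h by rewrite ler_pdivlMr//; lra.
have p2 : (s - y) / h <= - 2 by rewrite ler_pdivrMr//; lra.
by rewrite plateauE (@ramp1 _ (_ - 1)) ?(@ramp0 _ (_ + 2)) ?subr0//; lra.
Qed.

Lemma plateau_le1 x y h s : `|plateau x y h s| <= 1.
Proof.
rewrite plateauE; have /andP[p0 p1] := ramp_itv R ((s - x) / h - 1).
have /andP[q0 q1] := ramp_itv R ((s - y) / h + 2).
by rewrite ler_norml; apply/andP; split; lra.
Qed.

(** Since [x + h <= y - 2h] and [x + 2h <= y - h], both ramps are 0 to the left of [x + h] and both
    are 1 to the right of [y - h]. *)
Lemma plateau_supp x y h s : 0 < h -> 3 * h <= y - x ->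
  plateau x y h s != 0 -> x + h <= s <= y - h.
Proof.
move=> h0 hxy; apply: contraR; rewrite negb_and -!ltNge => /orP[s1|s1].
- by apply/eqP; apply: plateau_left => //; lra.
- by apply/eqP; apply: plateau_right => //; lra.
Qed.

Lemma test_function_plateau a b x y h : a <= x -> y <= b ->
  0 < h -> 3 * h <= y - x -> test_function `]a, b[ (plateau x y h).
Proof.
move=> ax yb h0 hxy.
have sub : closure [set s | plateau x y h s != 0] `<=` `[x + h, y - h].
  rewrite [X in _ `<=` X](closure_id _).1; last exact: itv_closed.
  by apply: closure_subset => s /= /plateau_supp; rewrite in_itv/=; exact.
split.
- by move=> n s; apply: smooth_derivable; apply: smooth_derive1n; exact: smooth_plateau.
- apply: subclosed_compact sub; [exact: closed_closure|exact: segment_compact].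
- move=> s /sub; rewrite /= !in_itv/= => /andP[s1 s2].
  by apply/andP; split; lra.
Qed.

(** The factor 3 makes the plateaus of this width admissible test functions for every [n], including
    [n = 0]. *)
Definition shrink x y (n : nat) : R := (y - x) / (3 * n.+1%:R).

Lemma shrink_gt0 x y n : x < y -> 0 < shrink x y n.
Proof. by move=> xy; rewrite divr_gt0 ?subr_gt0// mulr_gt0. Qed.

Lemma shrink_le x y n : x < y -> 3 * shrink x y n <= y - x.
Proof.
move=> xy; rewrite /shrink mulrA ler_pdivrMr ?mulr_gt0//.
by rewrite mulrC ler_pM2l ?subr_gt0// ler_peMr// ler1n.
Qed.

Lemma shrink_cvg x y : shrink x y n @[n --> \oo] --> 0.
Proof.
rewrite /shrink (_ : (fun n => _) = (fun n => ((y - x) / 3) * n.+1%:R^-1)); last first.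
  by apply/funext => n; rewrite invfM mulrA.
rewrite -[X in _ --> X](mulr0 ((y - x) / 3)); apply: cvgM; first exact: cvg_cst.
exact: cvg_harmonic.
Qed.

Lemma shrink_near x y e : 0 < e -> \forall n \near \oo, `|shrink x y n| < e.
Proof.
by move=> e0; have /cvgr0Pnorm_lt := shrink_cvg x y; apply.
Qed.

(** Off []x, y[] the plateaus vanish for every [n]; a point inside is eventually farther than twice
    the width from both ends, where the plateau equals 1. *)
Lemma plateau_cvg x y s : x < y ->
  \forall n \near \oo, plateau x y (shrink x y n) s = \1_(`]x, y[) s.
Proof.
move=> xy; have h0 n := shrink_gt0 x y n xy; have h3 n := shrink_le x y n xy.
have [sx|xs] := leP s x.
  apply: nearW => n; rewrite plateau_left ?indicE ?memNset//=.
  - by rewrite in_itv/= ltNge sx.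
  - by have := h0 n; lra.
  - by have := h0 n; have := h3 n; lra.
have [ys|sy] := leP y s.
  apply: nearW => n; rewrite plateau_right ?indicE ?memNset//=.
  - by rewrite in_itv/= (ltNge s) ys andbF.
  - by have := h0 n; have := h3 n; lra.
  - by have := h0 n; lra.
have d1 : 0 < (s - x) / 2 by rewrite divr_gt0 ?subr_gt0.
have d2 : 0 < (y - s) / 2 by rewrite divr_gt0 ?subr_gt0.
near=> n.
have e1 : `|shrink x y n| < (s - x) / 2 by near: n; exact: shrink_near.
have e2 : `|shrink x y n| < (y - s) / 2 by near: n; exact: shrink_near.
rewrite ger0_norm ?ltW// in e1; rewrite ger0_norm ?ltW// in e2.
rewrite plateau_middle ?indicE ?mem_set//=; last 2 first; [lra|lra|].
by rewrite in_itv/= xs.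
Unshelve. all: by end_near. Qed.

End plateau.

(** * Uniqueness of the distributional derivative *)

Section charge.
Context {R : realType}.
Notation BR := (measurableTypeR R).
Implicit Type nu : {charge set BR -> \bar R}.

Local Notation pos nu := (jordan_pos (hahnPN nu)).
Local Notation neg nu := (jordan_neg (hahnPN nu)).

Lemma charge_posneg nu (A : set BR) : measurable A ->
  nu A = (pos nu A - neg nu A)%E.
Proof.
by move=> mA; rewrite (jordan_decomp (hahnPN nu) mA) /cadd /= cscaleN1.
Qed.

Lemma sube_eqe (p q r s : \bar R) : p \is a fin_num -> q \is a fin_num ->
  r \is a fin_num -> s \is a fin_num ->
  (p - q = r - s)%E <-> (p + s = r + q)%E.
Proof.
move=> /fineK <- /fineK <- /fineK <- /fineK <-; rewrite -!EFinB -!EFinD.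
by split=> -[h]; congr EFin; lra.
Qed.

(* [nu1 = nu2] is rewritten as an equality between finite measures,
   [nu1^+ + nu2^- = nu2^+ + nu1^-], in order to use the uniqueness of measures. *)
Lemma charge_eq_rays (nu1 nu2 : {charge set BR -> \bar R}) :
  (forall x : R, nu1 `]x, +oo[ = nu2 `]x, +oo[) ->
  forall A : set BR, measurable A -> nu1 A = nu2 A.
Proof.
move=> h A mA.
have key (B : set BR) : measurable B ->
    nu1 B = nu2 B <-> measure_add (pos nu1) (neg nu2) B =
                      measure_add (pos nu2) (neg nu1) B.
  move=> mB; rewrite (charge_posneg nu1)// (charge_posneg nu2)// !measure_addE.
  by apply: sube_eqe; exact: fin_num_measure.
apply/key => //.
apply: (@measure_unique _ _ BR (@RGenOInfty.G R)
  (fun n => `]- n%:R, +oo[%classic)) => //.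
- exact: RGenOInfty.measurableE.
- move=> _ _ [x ->] [y ->]; exists (Num.max x y).
  by apply/seteqP; split=> z /=; rewrite !in_itv/= !andbT gt_max => /andP.
- by move=> n; exists (- n%:R).
- apply/seteqP; split=> // z _; exists (Num.truncn `|z|).+1 => //=.
  rewrite in_itv/= andbT ltrNl (le_lt_trans (ler_norm _))// normrN.
  exact: truncnS_gt.
- by move=> _ [x ->]; apply/key.
- move=> n; pose I : set BR := `]- n%:R, +oo[.
  have mI : measurable I by exact: measurable_itv.
  have : (measure_add (pos nu1) (neg nu2) I < +oo)%E.
    rewrite measure_addE.
    by apply: lte_add_pinfty; rewrite -ge0_fin_numE//; exact: fin_num_measure.
  by [].
Qed.

Lemma charge_off nu (O : set BR) : measurable O ->
  (forall A : set BR, measurable A -> A `&` O = set0 -> nu A = 0%E) ->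
  forall A : set BR, measurable A -> nu A = nu (A `&` O).
Proof.
move=> mO off A mA; rewrite [LHS](chargeDI nu mA mO).
by rewrite (off (A `\` O)) ?add0e ?setDKI//; exact: measurableD.
Qed.

(** Dominated convergence, with the constant 1 as the dominating function: it is integrable because
    [m] is finite. *)
Lemma integral_plateau_cvg (m : {finite_measure set BR -> \bar R}) (a b x y : R) :
  a <= x -> x < y -> y <= b ->
  (\int[m]_(s in `]a, b[) (plateau x y (shrink x y n) s)%:E @[n --> \oo] -->
   m `]x, y[)%E.
Proof.
move=> ax xy yb.
have mo : measurable (`]a, b[ : set BR) by exact: measurable_itv.
have -> : m `]x, y[%classic =
    (\int[m]_(s in `]a, b[) (\1_(`]x, y[%classic : set BR) s)%:E)%E.
  rewrite integral_indic// setIidl// => s /=; rewrite !in_itv/= => /andP[s1 s2].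
  by rewrite (le_lt_trans ax)// (lt_le_trans s2).
have mp n : measurable_fun setT (plateau x y (shrink x y n) : BR -> R).
  by apply: continuous_measurable_fun; apply: smooth_continuous; exact: smooth_plateau.
apply: (@dominated_cvg _ _ _ m _ mo _ _ (cst 1%E)) => //.
- by move=> n; apply/measurable_EFinP; exact: measurable_funTS.
- move=> s _; apply: cvg_near_cst; have := plateau_cvg x y s xy.
  by apply: filterS => n ->.
- exact: (@finite_measure_integrable_cst _ _ _ m _ 1).
- by move=> n s _; rewrite /= lee_fin plateau_le1.
Qed.

Lemma charge_integral_plateau_cvg nu (a b x y : R) :
  a <= x -> x < y -> y <= b ->
  (charge_integral nu `]a, b[ (EFin \o plateau x y (shrink x y n)) @[n --> \oo] -->
   nu `]x, y[)%E.
Proof.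
move=> ax xy yb; rewrite (charge_posneg nu)//; apply: cvgeB.
- by rewrite fin_num_adde_defl// fin_numN fin_num_measure.
- exact: integral_plateau_cvg.
- exact: integral_plateau_cvg.
Qed.

(** It suffices to compare rays. A ray meets []a, b[] in an interval []max x a, b[], whose measure
    is the limit of the pairings with plateaus, and these pairings are determined by [u]. *)
Lemma distr_deriv_unique (a b : R) (u : R -> R) (nu1 nu2 : {charge set BR -> \bar R}) :
  is_distr_deriv `]a, b[ u nu1 -> is_distr_deriv `]a, b[ u nu2 ->
  forall A : set BR, measurable A -> nu1 A = nu2 A.
Proof.
move=> [off1 D1] [off2 D2]; apply: charge_eq_rays => x.
have mo : measurable (`]a, b[ : set BR) by exact: measurable_itv.
have clip : `]x, +oo[ `&` `]a, b[ = `]Num.max x a, b[ :> set R.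
  apply/seteqP; split=> z /=; rewrite !in_itv/= andbT gt_max.
    by move=> [-> /andP[-> ->]].
  by move=> /andP[/andP[-> ->] ->].
rewrite (charge_off _ _ mo off1)// (charge_off _ _ mo off2)// clip.
have [yb|by_] := ltP (Num.max x a) b; last first.
  by rewrite set_itv_ge ?charge0// bnd_simp -leNgt.
have ay : a <= Num.max x a by rewrite le_max lexx orbT.
have := @charge_integral_plateau_cvg nu1 _ _ _ _ ay yb (lexx b).
have := @charge_integral_plateau_cvg nu2 _ _ _ _ ay yb (lexx b).
pose phi n := plateau (Num.max x a) b (shrink (Num.max x a) b n).
have E n : charge_integral nu2 `]a, b[ (EFin \o phi n) =
    charge_integral nu1 `]a, b[ (EFin \o phi n).
  have tf : test_function `]a, b[ (phi n).
    by apply: test_function_plateau => //; [exact: shrink_gt0|exact: shrink_le].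
  by apply: oppe_inj; rewrite -D1// -D2.
under eq_fun do rewrite E.
by move=> h2 h1; exact: (cvg_unique _ h1 h2).
Qed.

End charge.

(** * Values of a BV function at Lebesgue points *)

Section lebesgue_point.
Context {R : realType}.
Notation BR := (measurableTypeR R).
Notation mu := (@lebesgue_measure R).

Lemma integrable_mulr_bounded (D : set BR) (V k : R -> R) (M : R) :
  measurable D -> mu.-integrable D (EFin \o V) ->
  measurable_fun D (k : BR -> R) -> (forall s, D s -> `|k s| <= M) ->
  mu.-integrable D (fun s => (V s * k s)%:E).
Proof.
move=> mD iV mk kM.
have iM : mu.-integrable D (fun s => (M * V s)%:E).
  by under eq_fun do rewrite EFinM; exact: integrableZl.
have mV : measurable_fun D (V : BR -> R) by apply/measurable_EFinP; exact: measurable_int iV.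
apply: le_integrable iM => //.
- by apply/measurable_EFinP; exact: measurable_funM.
- move=> s Ds; rewrite !abse_EFin lee_fin !normrM mulrC ler_wpM2r//.
  by rewrite (le_trans (kM _ Ds))// ler_norm.
Qed.

(** As [k n] has mass 1, the error is the integral of [(V - V x) * k n] over the ball of radius
    [3h]. That ball has measure [6h], so the error is at most [6C] times the mean deviation of [V]
    from [V x], which tends to 0 at a Lebesgue point. Neither the sign nor the centring of the
    kernel matters. *)
Lemma lebesgue_pt_kernel_cvg (V : R -> R) (x C : R) (h : nat -> R)
    (k : nat -> R -> R) :
  mu.-integrable setT (EFin \o V) -> lebesgue_pt V x ->
  (forall n, 0 < h n) -> h n @[n --> \oo] --> 0 ->
  (forall n, measurable_fun setT (k n : BR -> R)) ->
  (forall n s, `|k n s| <= C / h n) ->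
  (forall n s, ~ ball x (3 * h n) s -> k n s = 0) ->
  (forall n, \int[mu]_s (k n s)%:E = 1)%E ->
  (\int[mu]_s (V s * k n s)%:E @[n --> \oo] --> (V x)%:E)%E.
Proof.
move=> iV Lx h0 hc mk kC koff k1.
have mV : measurable_fun setT (V : BR -> R) by apply/measurable_EFinP; exact: measurable_int iV.
have ifb n : mu (ball x (3 * h n)) = (6 * h n)%:E.
  rewrite lebesgue_measure_ball ?mulr_ge0 ?ltW//.
  by congr EFin; rewrite -mulr_natl; ring.
have mb n : measurable (ball x (3 * h n) : set BR) by exact: measurable_ball.
have ik n : mu.-integrable setT (EFin \o k n).
  have ib : mu.-integrable (ball x (3 * h n)) (EFin \o k n).
    apply: measurable_bounded_integrable => //.
    - by have := ltry (6 * h n); rewrite -ifb.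
    - exact: measurable_funTS.
    - exists (C / h n); split; first exact: num_real.
      by move=> M CM s _; exact: (le_trans (kC n s) (ltW CM)).
  have <- : (EFin \o k n) \_ (ball x (3 * h n)) = EFin \o k n.
    apply/funext => s; rewrite patchE; case: ifPn => // /negP sB.
    by rewrite /= koff// => /mem_set.
  exact: (integrable_mkcond _ (mb n)).1 ib.
have iVk n : mu.-integrable setT (fun s => (V s * k n s)%:E).
  by apply: (@integrable_mulr_bounded _ _ _ (C / h n)).
have iVxk n : mu.-integrable setT (fun s => (V x * k n s)%:E).
  by under eq_fun do rewrite EFinM; exact: (integrableZl measurableT (V x) (ik n)).
have E n : (\int[mu]_s (V s * k n s)%:E - (V x)%:E =
    \int[mu]_(s in ball x (3 * h n)) ((V s - V x) * k n s)%:E)%E.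
  have -> : ((V x)%:E = \int[mu]_s (V x * k n s)%:E)%E.
    by rewrite -[LHS]mule1 -(k1 n) -integralZl//; exact: ik.
  have <- := @integralB_EFin _ BR R mu setT _ _ measurableT (iVk n) (iVxk n).
  rewrite [RHS]integral_mkcond; apply: eq_integral => s _.
  rewrite patchE; case: ifPn => [_|/negP sB]; first by rewrite -EFinB mulrBl.
  by rewrite koff ?mulr0 ?subee// => /mem_set.
have B n : (`| \int[mu]_s (V s * k n s)%:E - (V x)%:E | <=
    (6 * C)%:E * davg V x (3 * h n))%E.
  have mVx : measurable_fun (ball x (3 * h n)) (fun s : BR => (V s - V x)%:E).
    by apply/measurable_EFinP; apply: measurable_funTS; exact: measurable_funB.
  rewrite E; apply: (le_trans (le_abse_integral _ _ _)) => //.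
    apply/measurable_EFinP; apply: measurable_funM; first exact/measurable_EFinP.
    exact: measurable_funTS.
  rewrite /davg /iavg ifb muleA.
  have -> : ((6 * C)%:E * (6 * h n)%:E^-1 = (C / h n)%:E)%E.
    rewrite inver ifF ?gt_eqF ?mulr_gt0// -EFinM; congr EFin.
    by rewrite invfM mulrACA mulfV// mul1r.
  have C0 : 0 <= C / h n by rewrite (le_trans _ (kC n 0)).
  rewrite -ge0_integralZl//; last by exact: measurableT_comp.
  apply: ge0_le_integral => //.
  - apply: measurableT_comp => //; apply/measurable_EFinP.
    apply: measurable_funM; first exact/measurable_EFinP.
    exact: measurable_funTS.
  - by apply: measurable_funeM; exact: measurableT_comp.
  - move=> s _; rewrite abse_EFin -EFinM lee_fin normrM mulrC.
    by rewrite ler_wpM2r.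
apply/(@sube_cvg0 _ _ _ _ (fun n => \int[mu]_s (V s * k n s)%:E)%E) => //.
apply/cvg_abse0P.
apply: (@squeeze_cvge _ _ _ _ (cst 0%E) _ (fun n => (6 * C)%:E * davg V x (3 * h n)))%E.
- by near=> n; rewrite /= abse_ge0 B.
- exact: cvg_cst.
- rewrite -[X in _ --> X](mule0 (6 * C)%:E); apply: cvgeZl => //.
  move/cvge_at_rightP : Lx; apply; split; first by move=> n; rewrite mulr_gt0.
  by rewrite -[X in _ --> X](mulr0 (3 : R)); apply: cvgM => //; exact: cvg_cst.
Unshelve. all: by end_near. Qed.

End lebesgue_point.

Section representation.
Context {R : realType}.
Notation BR := (measurableTypeR R).
Notation mu := (@lebesgue_measure R).

Lemma measurable_ramp_kernel (h d : R) :
  measurable_fun setT (ramp_kernel h d : BR -> R).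
Proof.
by apply: continuous_measurable_fun; apply: smooth_continuous; exact: smooth_ramp_kernel.
Qed.

Lemma ramp_kernel_off (h d s : R) : 0 < h ->
  ~ (- (h * d) <= s <= h * (1 - d)) -> ramp_kernel h d s = 0.
Proof.
move=> h0 /negP; rewrite negb_and -!ltNge => s1.
rewrite /ramp_kernel derive1_ramp_eq0 ?mulr0//; case/orP: s1 => s1; apply/orP; [left|right].
- by rewrite -ltrBrDr sub0r ltr_pdivrMl// mulrN.
- by rewrite -ltrBlDr ltr_pdivlMl.
Qed.

Lemma integral_ramp_kernel (h d : R) : 0 < h -> (\int[mu]_s (ramp_kernel h d s)%:E = 1)%E.
Proof.
move=> h0; have ab : - (h * d) < h * (1 - d) by rewrite -mulrN ltr_pM2l//; lra.
have -> : (\int[mu]_s (ramp_kernel h d s)%:E =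
    \int[mu]_(s in `[(- (h * d))%R, (h * (1 - d))%R]) (ramp_kernel h d s)%:E)%E.
  rewrite [RHS]integral_mkcond; apply: eq_integral => s _.
  rewrite patchE; case: ifPn => // /negP sB; rewrite ramp_kernel_off// => s1.
  by apply: sB; rewrite inE /= in_itv.
have D s := smooth_derivable _ _ (smooth_ramp_affine R h^-1 d) s.
have C := smooth_continuous _ _ (smooth_ramp_affine R h^-1 d).
rewrite (@continuous_FTC2 _ _ (fun s => ramp (h^-1 * s + d)))//.
- rewrite ramp1 ?ramp0 ?sube0//.
  + by rewrite mulrN mulKf ?gt_eqF// addNr.
  + by rewrite mulKf ?gt_eqF// subrK.
- by apply: continuous_subspaceT; apply: smooth_continuous; exact: smooth_ramp_kernel.
- split => //.
  + by apply: cvg_at_right_filter; exact: C.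
  + by apply: cvg_at_left_filter; exact: C.
- by move=> s _; rewrite derive1_ramp_affine.
Qed.

Lemma ramp_kernel_bounded : exists C : R, forall h d s, 0 < h -> `|ramp_kernel h d s| <= C / h.
Proof.
have [C C0 hC] := derive1_ramp_bounded R; exists C => h d s h0.
by rewrite /ramp_kernel normrM mulrC (@gtr0_norm _ h^-1) ?ler_pM2r ?invr_gt0.
Qed.

Lemma ramp_kernel_cvg (V : R -> R) (x : R) (h d : nat -> R) :
  mu.-integrable setT (EFin \o V) -> lebesgue_pt V x ->
  (forall n, 0 < h n) -> h n @[n --> \oo] --> 0 ->
  (forall n s, - (h n * d n) <= s <= h n * (1 - d n) -> ball x (3 * h n) s) ->
  (\int[mu]_s (V s * ramp_kernel (h n) (d n) s)%:E @[n --> \oo] --> (V x)%:E)%E.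
Proof.
move=> iV Lx h0 hc dsupp; have [C hC] := ramp_kernel_bounded.
apply: (lebesgue_pt_kernel_cvg V x C h (fun n => ramp_kernel (h n) (d n))) => //.
- by move=> n; exact: measurable_ramp_kernel.
- by move=> n s; exact: hC.
- by move=> n s sB; apply: ramp_kernel_off => // /dsupp.
- by move=> n; exact: integral_ramp_kernel.
Qed.

Lemma distr_deriv_repr (a b : R) (v : R -> R) (nu : {charge set BR -> \bar R}) (x y : R) :
  mu.-integrable `]a, b[ (EFin \o v) -> is_distr_deriv `]a, b[ v nu ->
  lebesgue_pt (v \_ `]a, b[) x -> lebesgue_pt (v \_ `]a, b[) y ->
  a < x -> x < y -> y < b -> nu `]x, y[ = (v y - v x)%:E.
Proof.
move=> iv [_ Dv] Lx Ly ax xy yb; set V := v \_ `]a, b[.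
have mo : measurable (`]a, b[ : set BR) by exact: measurable_itv.
have iV : mu.-integrable setT (EFin \o V).
  by rewrite /V -restrict_EFin; exact: (integrable_mkcond _ mo).1 iv.
pose h := shrink x y.
have h0 n : 0 < h n by exact: shrink_gt0.
have hc : h n @[n --> \oo] --> 0 by exact: shrink_cvg.
pose d1 n := - ((h n)^-1 * x) - 1.
pose d2 n := 2 - (h n)^-1 * y.
(* The two kernels are the halves of the derivative of the plateau. They live on [[x + h, x + 2h]]
   and [[y - 2h, y - h]], hence in the balls of radius [3h] around [x] and [y]. *)
have c1 : (\int[mu]_s (V s * ramp_kernel (h n) (d1 n) s)%:E @[n --> \oo] --> (V x)%:E)%E.
  apply: ramp_kernel_cvg => // n s.
  have hn := h0 n; have -> : h n * d1 n = - x - h n by rewrite /d1; field; rewrite gt_eqF//.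
  have -> : h n * (1 - d1 n) = x + 2 * h n by rewrite /d1; field; rewrite gt_eqF//.
  by move=> /andP[s1 s2]; rewrite /ball /= ltr_norml; apply/andP; split; lra.
have c2 : (\int[mu]_s (V s * ramp_kernel (h n) (d2 n) s)%:E @[n --> \oo] --> (V y)%:E)%E.
  apply: ramp_kernel_cvg => // n s.
  have hn := h0 n; have -> : h n * d2 n = 2 * h n - y by rewrite /d2; field; rewrite gt_eqF//.
  have -> : h n * (1 - d2 n) = y - h n by rewrite /d2; field; rewrite gt_eqF//.
  by move=> /andP[s1 s2]; rewrite /ball /= ltr_norml; apply/andP; split; lra.
have c := @charge_integral_plateau_cvg R nu _ _ _ _ (ltW ax) xy (ltW yb).
have ik n d : mu.-integrable setT (fun s : BR => (V s * ramp_kernel (h n) (d n) s)%:E).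
  have [C hC] := ramp_kernel_bounded.
  apply: (integrable_mulr_bounded _ _ _ (C / h n)) => //.
  - exact: measurable_ramp_kernel.
  - by move=> s _; exact: hC.
have E n : (\int[mu]_s (V s * ramp_kernel (h n) (d1 n) s)%:E -
    \int[mu]_s (V s * ramp_kernel (h n) (d2 n) s)%:E =
    - charge_integral nu `]a, b[ (EFin \o plateau x y (h n)))%E.
  rewrite -Dv; last first.
    apply: test_function_plateau; [exact: ltW|exact: ltW|exact: h0|exact: shrink_le].
  have <- := @integralB_EFin _ BR R mu setT _ _ measurableT (ik n d1) (ik n d2).
  rewrite [RHS]integral_mkcond; apply: eq_integral => s _.
  rewrite /V !patchE; case: ifPn => sI; last by rewrite !mul0r subee.
  by rewrite derive1_plateau -EFinB -mulrBr.
have c3 := cvgeB (isT : ((V x)%:E +? - (V y)%:E)%E) c1 c2.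
have c4 := cvgeN c.
(* Both sides of the integration by parts [E] are passed to the limit. *)
have e : ((V x)%:E - (V y)%:E = - nu `]x, y[)%E.
  have c5 : ((fun n => \int[mu]_s (V s * ramp_kernel (h n) (d1 n) s)%:E -
    \int[mu]_s (V s * ramp_kernel (h n) (d2 n) s)%:E) @ \oo --> - nu `]x, y[)%E.
    by under eq_fun do rewrite E; exact: c4.
  exact: (cvg_unique _ (c3 eventually_filter) c5).
have V1 z : a < z -> z < b -> V z = v z.
  by move=> az zb; rewrite /V patchE mem_set//= in_itv/= az zb.
have xb := lt_trans xy yb; have ay := lt_trans ax xy.
rewrite -[LHS]oppeK -e !V1//.
by rewrite -EFinB -EFinN opprB.
Qed.

End representation.

(** * Moving mass between atoms *)

Section charge_dirac.
Context {R : realType}.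
Notation BR := (measurableTypeR R).
Implicit Type nu : {charge set BR -> \bar R}.

Local Notation pos nu := (jordan_pos (hahnPN nu)).
Local Notation neg nu := (jordan_neg (hahnPN nu)).

Lemma bounded_integrable (m : {measure set BR -> \bar R}) (D : set BR) (g : R -> R) (M : R) :
  measurable D -> (m setT < +oo)%E -> measurable_fun D (g : BR -> R) ->
  (forall s, D s -> `|g s| <= M) -> m.-integrable D (EFin \o g).
Proof.
move=> mD mT mg gM; apply: measurable_bounded_integrable => //.
- by apply: le_lt_trans mT; apply: le_measure; rewrite ?inE.
- by exists M; split; [exact: num_real|move=> N MN s Ds; exact: le_trans (gM s Ds) (ltW MN)].
Qed.

Lemma measure_add_lty (m1 m2 : {measure set BR -> \bar R}) :
  (m1 setT < +oo)%E -> (m2 setT < +oo)%E ->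
  (measure_add m1 m2 setT < +oo)%E.
Proof. by move=> h1 h2; rewrite measure_addE lte_add_pinfty. Qed.

Lemma fin_num_lty (m : {measure set BR -> \bar R}) (A : set BR) :
  (m setT < +oo)%E -> measurable A -> m A \is a fin_num.
Proof.
move=> mT mA; rewrite ge0_fin_numE//.
by apply: le_lt_trans mT; apply: le_measure; rewrite ?inE.
Qed.

(** Any splitting of [nu] into finite measures may replace the Jordan one: [nu^+ + m2] and
    [m1 + nu^-] are the same measure, so the integrals against them agree, and finiteness allows the
    terms to be rearranged. *)
Lemma charge_integral_diff nu (m1 m2 : {measure set BR -> \bar R})
    (D : set BR) (g : R -> R) (M : R) :
  measurable D -> measurable_fun D (g : BR -> R) -> (forall s, D s -> `|g s| <= M) ->
  (m1 setT < +oo)%E -> (m2 setT < +oo)%E ->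
  (forall A : set BR, measurable A -> nu A = m1 A - m2 A)%E ->
  (charge_integral nu D (EFin \o g) =
   \int[m1]_(s in D) (g s)%:E - \int[m2]_(s in D) (g s)%:E)%E.
Proof.
move=> mD mg gM f1 f2 E.
have fp : (pos nu setT < +oo)%E by rewrite -ge0_fin_numE//; exact: fin_num_measure.
have fn : (neg nu setT < +oo)%E by rewrite -ge0_fin_numE//; exact: fin_num_measure.
have I (m : {measure set BR -> \bar R}) : (m setT < +oo)%E -> m.-integrable D (EFin \o g).
  by move=> fm; exact: bounded_integrable gM.
have F (m : {measure set BR -> \bar R}) : (m setT < +oo)%E ->
    (\int[m]_(s in D) (g s)%:E)%E \is a fin_num.
  by move=> /I /integrable_fin_num; exact.
rewrite /charge_integral; apply/sube_eqe; try exact: F.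
have A1 := @integral_measure_add _ BR R (pos nu) m2 D mD _ (I _ fp) (I _ f2).
have A2 := @integral_measure_add _ BR R m1 (neg nu) D mD _ (I _ f1) (I _ fn).
rewrite -[LHS]A1 -[RHS]A2; apply: eq_measure_integral => A mA _.
rewrite [LHS]measure_addE [RHS]measure_addE.
apply/sube_eqe; try exact: fin_num_measure; try exact: fin_num_lty.
by rewrite -E// (charge_posneg nu).
Qed.

Lemma charge_integral_fin_num nu (D : set BR) (g : R -> R) (M : R) :
  measurable D -> measurable_fun D (g : BR -> R) ->
  (forall s, D s -> `|g s| <= M) ->
  charge_integral nu D (EFin \o g) \is a fin_num.
Proof.
move=> mD mg gM; rewrite fin_numB; apply/andP.
have I (m : {finite_measure set BR -> \bar R}) : (\int[m]_(s in D) (g s)%:E)%E \is a fin_num.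
  apply: integrable_fin_num => //; apply: bounded_integrable gM => //.
  by rewrite -ge0_fin_numE//; exact: fin_num_measure.
by split; exact: I.
Qed.

Lemma integral_mscale_dirac (t : {nonneg R}) (p : BR) (D : set BR) (g : R -> R) :
  measurable D -> measurable_fun D (g : BR -> R) -> D p ->
  (\int[mscale t (\d_p : {measure set BR -> \bar R})]_(s in D) (g s)%:E =
   (t%:num * g p)%:E)%E.
Proof.
move=> mD mg Dp.
have mgE : measurable_fun D (EFin \o g : BR -> \bar R) by exact/measurable_EFinP.
rewrite integralE !ge0_integral_mscale//; [|exact: measurable_funeneg|exact: measurable_funepos].
rewrite !integral_dirac//; [|exact: measurable_funeneg|exact: measurable_funepos].
rewrite !diracE mem_set//= !mul1e EFinM -[(g p)%:E]/((EFin \o g) p).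
rewrite [in RHS](funeposneg (EFin \o g)) muleBr//.
by rewrite funeposE funenegE /= -!EFin_max.
Qed.

(** The splitting used is [nu^+ + t \d_p] minus [nu^- + t \d_q]; the sign of [t] makes both of them
    measures. *)
Lemma charge_integral_dirac nu nu' (t : R) (p q : BR) (D : set BR) (g : R -> R) (M : R) :
  measurable D -> measurable_fun D (g : BR -> R) -> (forall s, D s -> `|g s| <= M) ->
  0 <= t -> D p -> D q ->
  (forall A : set BR, measurable A -> nu' A = nu A + t%:E * \d_p A - t%:E * \d_q A)%E ->
  (charge_integral nu' D (EFin \o g) =
   charge_integral nu D (EFin \o g) + (t * g p)%:E - (t * g q)%:E)%E.
Proof.
move=> mD mg gM t0 Dp Dq E.
have fp : (pos nu setT < +oo)%E by rewrite -ge0_fin_numE//; exact: fin_num_measure.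
have fn : (neg nu setT < +oo)%E by rewrite -ge0_fin_numE//; exact: fin_num_measure.
pose tn : {nonneg R} := NngNum t0.
have fd (z : BR) : (mscale tn (\d_z : {measure set BR -> \bar R}) setT < +oo)%E.
  by rewrite /mscale /= diracT mule1 ltry.
pose m1 : {measure set BR -> \bar R} :=
  measure_add (pos nu) (mscale tn (\d_p : {measure set BR -> \bar R})).
pose m2 : {measure set BR -> \bar R} :=
  measure_add (neg nu) (mscale tn (\d_q : {measure set BR -> \bar R})).
have I (m : {measure set BR -> \bar R}) : (m setT < +oo)%E -> m.-integrable D (EFin \o g).
  by move=> fm; exact: bounded_integrable gM.
have F (m : {measure set BR -> \bar R}) : (m setT < +oo)%E ->
    (\int[m]_(s in D) (g s)%:E)%E \is a fin_num.
  by move=> /I /integrable_fin_num; exact.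
have A1 := @integral_measure_add _ BR R (pos nu) _ D mD _ (I _ fp) (I _ (fd p)).
have A2 := @integral_measure_add _ BR R (neg nu) _ D mD _ (I _ fn) (I _ (fd q)).
rewrite (@charge_integral_diff nu' m1 m2 D g M)//.
- rewrite [X in (X - _)%E]A1 [X in (_ - X)%E]A2 /charge_integral.
  rewrite !integral_mscale_dirac//=.
  move: (F _ fp) (F _ fn) => /fineK <- /fineK <-; rewrite -!(EFinB, EFinD).
  by congr EFin; lra.
- exact: (measure_add_lty _ _ fp (fd p)).
- exact: (measure_add_lty _ _ fn (fd q)).
- move=> A mA; rewrite E// (charge_posneg nu)//.
  have -> : m1 A = (pos nu A + t%:E * \d_p A)%E by exact: measure_addE.
  have -> : m2 A = (neg nu A + t%:E * \d_q A)%E by exact: measure_addE.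
  have Fp := fin_num_measure (pos nu) A mA.
  have Fn := fin_num_measure (neg nu) A mA.
  move: Fp Fn => /fineK <- /fineK <-; rewrite !diracE -!EFinM -!(EFinB, EFinD).
  by congr EFin; lra.
Qed.

End charge_dirac.

Section total_var.
Context {R : realType}.
Notation BR := (measurableTypeR R).
Implicit Type nu : {charge set BR -> \bar R}.

Lemma total_varE nu (A : set BR) : measurable A ->
  total_var nu A = (nu (A `&` hahnP nu) - nu (A `\` hahnP nu))%E.
Proof.
move=> mA; have [[mP _] [mN _] PN0 PN] := hahnPN nu.
have AN : A `\` hahnP nu = A `&` hahnN nu.
  apply/seteqP; split => x [Ax].
    by move=> nP; split => //; have : [set: BR] x by []; rewrite -PN0 => -[].
  by move=> Nx; split => // Px; have : (hahnP nu `&` hahnN nu) x by []; rewrite PN.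
rewrite /total_var /charge_variation /= jordan_posE jordan_negE cjordan_posE cjordan_negE.
by rewrite /crestr0 /crestr !mem_set// AN.
Qed.

Lemma total_var_fin_num nu (A : set BR) : measurable A -> total_var nu A \is a fin_num.
Proof.
move=> mA; rewrite /total_var /charge_variation.
by rewrite fin_numD !fin_num_measure.
Qed.

Lemma le_total_var nu (A : set BR) : measurable A -> (`|nu A| <= total_var nu A)%E.
Proof. by move=> mA; exact: abse_charge_variation. Qed.

(** [|nu|] is additive over the partition of [A] by [B] and dominates [|nu A|] on each piece. By
    [total_varE], the bound is attained when [B] is the positive set. *)
Lemma total_var_ge nu (A B : set BR) : measurable A -> measurable B ->
  (nu (A `&` B) - nu (A `\` B) <= total_var nu A)%E.
Proof.
move=> mA mB; have mI : measurable (A `&` B) by exact: measurableI.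
have mD : measurable (A `\` B) by exact: measurableD.
have -> : total_var nu A = (total_var nu (A `\` B) + total_var nu (A `&` B))%E.
  have := chargeDI (charge_variation (hahnPN nu)) mA mB.
  exact.
rewrite addeC; apply: leeD.
- by apply: le_trans (le_total_var nu _ mD); rewrite -abseN lee_abs.
- by apply: le_trans (le_total_var nu _ mI); rewrite lee_abs.
Qed.

(* Since [|nu'|(O) = nu'(O `&` P) - nu'(O `\` P)] for the positive set [P] of [nu'],
   it suffices to bound the same difference for [nu], with [x] put on either
   side of the partition. *)
Lemma total_var_transfer nu nu' (O : set BR) (x z : BR) (t c : R) :
  measurable O -> O x -> O z -> nu [set x] = c%:E ->
  (0 <= t <= c) || (c <= t <= 0) ->
  (forall A : set BR, measurable A -> nu' A = nu A + t%:E * \d_z A - t%:E * \d_x A)%E ->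
  (total_var nu' O <= total_var nu O)%E.
Proof.
move=> mO Ox Oz nx tc E.
have [[mP _] _ _ _] := hahnPN nu'; set P := hahnP nu' in mP.
have mX : measurable ([set x] : set BR) by exact: measurable_set1.
have mI : measurable (O `&` P) by exact: measurableI.
have mD : measurable (O `\` P) by exact: measurableD.
have F (A : set BR) : measurable A -> nu A \is a fin_num by move=> mA; exact: fin_num_measure.
rewrite total_varE// -/P !E// !diracE.
have h0 := total_var_ge nu O P mO mP.
have h1 := total_var_ge nu O (P `|` [set x]) mO (measurableU _ _ mP mX).
have h2 := total_var_ge nu O (P `\` [set x]) mO (measurableD mP mX).
have fT := total_var_fin_num nu O mO.
have zI : (z \in O `&` P) = (z \in P) by rewrite in_setI mem_set.
have zD : (z \in O `\` P) = (z \notin P) by rewrite in_setD mem_set.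
have xI : (x \in O `&` P) = (x \in P) by rewrite in_setI mem_set.
have xD : (x \in O `\` P) = (x \notin P) by rewrite in_setD mem_set.
rewrite zI zD xI xD.
(* If [x] is in [P], the difference for [nu'] is that for [nu] changed by 0 or [- 2t], according to
   the side of [z], while taking [x] out of [P] changes the latter by [- 2c]. If [x] is not in [P],
   the changes are 0 or [2t], and [2c]. As [t] lies between 0 and [c], one of the two bounds for
   [nu] applies. *)
have [/set_mem xP|/negP xP] := boolP (x \in P).
- have mI' : measurable (O `&` (P `\` [set x])).
    by apply: measurableI => //; exact: measurableD.
  have e1 : O `&` P = O `&` (P `\` [set x]) `|` [set x].
    apply/seteqP; split => y /= => [[Oy Py]|[[Oy [Py _]]|->]] //.
    by have [->|/eqP yx] := eqVneq y x; [right|left].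
  have e2 : O `\` (P `\` [set x]) = O `\` P `|` [set x].
    apply/seteqP; split => y /= => [[Oy nP]|[[Oy nP]|->]].
    - have [->|/eqP yx] := eqVneq y x; [by right|left; split => // Py].
      by apply: nP.
    - by split => // -[].
    - by split => // -[].
  have n1 : nu (O `&` P) = (nu (O `&` (P `\` [set x])) + c%:E)%E.
    rewrite -nx [in LHS]e1 chargeU//.
    by apply/seteqP; split => y //= [[_ [_ +]]] => /[apply].
  move: h2; rewrite e2 chargeU//; last first.
    by apply/seteqP; split => y //= [[_ nP] yx]; apply: nP; rewrite yx.
  rewrite n1 nx in h0 *.
  move: (F _ mI') (F _ mD) fT h0 => /fineK <- /fineK <- /fineK <-.
  rewrite -!EFinM -!(EFinB, EFinD) !lee_fin.
  by case: (z \in P) => /=; case/orP: tc => /andP[]; lra.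
- have mD' : measurable (O `\` (P `|` [set x])).
    by apply: measurableD => //; exact: measurableU.
  have nP : ~ P x by move=> Px; apply: xP; exact: mem_set.
  have e1 : O `&` (P `|` [set x]) = O `&` P `|` [set x].
    apply/seteqP; split => y /= => [[Oy [Py|->]]|[[Oy Py]|->]]; 
      [by left|by right|by split => //; left|by split => //; right].
  have e2 : O `\` P = O `\` (P `|` [set x]) `|` [set x].
    apply/seteqP; split => y /= => [[Oy Py]|[[Oy Py]|->]] //.
      by have [->|/eqP yx] := eqVneq y x; [right|left; split => // -[]].
    by split => // Py'; apply: Py; left.
  have n1 : nu (O `\` P) = (nu (O `\` (P `|` [set x])) + c%:E)%E.
    rewrite -nx [in LHS]e2 chargeU//.
    by apply/seteqP; split => y //= [[_ +] yx]; apply; right.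
  move: h1; rewrite e1 chargeU//; last first.
    by apply/seteqP; split => y //= [[_ Py] yx]; apply: nP; rewrite -yx.
  rewrite n1 nx in h0 *.
  move: (F _ mI) (F _ mD') fT h0 => /fineK <- /fineK <- /fineK <-.
  rewrite -!EFinM -!(EFinB, EFinD) !lee_fin.
  by case: (z \in P) => /=; case/orP: tc => /andP[]; lra.
Qed.

End total_var.

(** * The competitor *)

Section competitor.
Context {R : realType}.
Notation BR := (measurableTypeR R).
Notation mu := (@lebesgue_measure R).
Implicit Type nu : {charge set BR -> \bar R}.

Definition raise (u : R -> R) (t p q s : R) : R := u s + t * \1_(`]p, q[ : set R) s.

Lemma continuous_bounded_itv (a b : R) (phi : R -> R) : continuous phi ->
  exists M, forall s, `]a, b[ s -> `|phi s| <= M.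
Proof.
move=> cphi; have [M [_ /= hM]] := @compact_bounded R R^o _
  (continuous_compact (continuous_subspaceT cphi) (@segment_compact R a b)).
exists (`|M| + 1) => s ab; apply: hM; first by rewrite ltr_pwDr ?ler_norm.
by exists s => //; apply: subset_itv_oo_cc.
Qed.

(** The fundamental theorem of calculus on []p, q[]. The added term is minus the pairing of [phi]
    with [t \d_p - t \d_q]. *)
Lemma integral_raise (a b p q t : R) (u phi : R -> R) :
  a < p -> p < q -> q < b -> mu.-integrable `]a, b[ (EFin \o u) ->
  (forall n x, derivable (derive1n n phi) x 1) ->
  (\int[mu]_(s in `]a, b[) (raise u t p q s * derive1 phi s)%:E =
   \int[mu]_(s in `]a, b[) (u s * derive1 phi s)%:E + (t * (phi q - phi p))%:E)%E.
Proof.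
move=> ap pq qb iu dphi.
have mo : measurable (`]a, b[ : set BR) by exact: measurable_itv.
have mi : measurable (`]p, q[ : set BR) by exact: measurable_itv.
have cphi : continuous phi by apply: derivable_continuous; exact: (dphi 0).
have cphi' : continuous (derive1 phi) by apply: derivable_continuous; exact: (dphi 1%N).
have mphi' : measurable_fun setT (derive1 phi : BR -> R) by exact: continuous_measurable_fun.
have [M hM] := continuous_bounded_itv a b _ cphi'.
have i1 : mu.-integrable `]a, b[ (fun s : BR => (u s * derive1 phi s)%:E).
  by apply: (integrable_mulr_bounded _ _ _ M) => //; exact: measurable_funTS.
have i2 : mu.-integrable `]a, b[ (fun s : BR => (t * \1_(`]p, q[ : set R) s * derive1 phi s)%:E).
  apply: (integrable_mulr_bounded _ (fun s => t * \1_(`]p, q[ : set R) s) _ M) => //.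
    have i0 : mu.-integrable `]a, b[ (EFin \o (\1_(`]p, q[ : set R) : R -> R)).
      exact: (integrableS measurableT mo _ (@integrable_indic_itv R p q false true)).
    have := integrableZl mo t i0.
    by rewrite /= /comp /=.
  exact: measurable_funTS.
have -> : (\int[mu]_(s in `]a, b[) (raise u t p q s * derive1 phi s)%:E =
   \int[mu]_(s in `]a, b[) ((u s * derive1 phi s)%:E +
     (t * \1_(`]p, q[ : set R) s * derive1 phi s)%:E))%E.
  by apply: eq_integral => s _; rewrite /raise mulrDl.
rewrite integralD_EFin//; congr (_ + _)%E.
have i3 : mu.-integrable `]a, b[ ((EFin \o derive1 phi) \_ `]p, q[).
  apply/integrable_restrict => //; apply: (@integrableS _ _ _ mu `[p, q]).
  - exact: measurable_itv.
  - exact: measurableI.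
  - by move=> s [_]; exact: subset_itv_oo_cc.
  - apply: continuous_compact_integrable; first exact: segment_compact.
    exact: continuous_subspaceT.
have -> : (\int[mu]_(s in `]a, b[) (t * \1_(`]p, q[ : set R) s * derive1 phi s)%:E =
   \int[mu]_(s in `]a, b[) (t%:E * ((EFin \o derive1 phi) \_ `]p, q[) s))%E.
  apply: eq_integral => s _; rewrite patchE indicE; case: ifPn => _ /=.
    by rewrite mulr1 EFinM.
  by rewrite mulr0 mul0r mule0.
rewrite integralZl// -integral_mkcondr setIidr; last first.
  by move=> s /=; rewrite !in_itv/= => /andP[s1 s2]; rewrite (lt_trans ap)// (lt_trans s2).
(* Adding the null end points gives the closed interval on which the fundamental theorem is
   stated. *)
rewrite -(@integral_itv_bndoo _ _ _ _ true false); last first.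
  by apply/measurable_EFinP; exact: measurable_funTS.
rewrite /= (@continuous_FTC2 _ _ phi)// -?EFinB -?EFinM//.
- exact: continuous_subspaceT.
- split; first by move=> s _; exact: (dphi 0).
  + by apply: cvg_at_right_filter; exact: cphi.
  + by apply: cvg_at_left_filter; exact: cphi.
Qed.

Lemma is_distr_deriv_raise (a b p q t : R) (u : R -> R) nu :
  a < p -> p < q -> q < b -> mu.-integrable `]a, b[ (EFin \o u) ->
  is_distr_deriv `]a, b[ u nu ->
  exists2 nu' : {charge set BR -> \bar R}, is_distr_deriv `]a, b[ (raise u t p q) nu' &
   (forall A : set BR, measurable A ->
     nu' A = nu A + t%:E * \d_(p : BR) A - t%:E * \d_(q : BR) A)%E.
Proof.
move=> ap pq qb iu [off D].
pose dp : {charge set BR -> \bar R} := charge_of_finite_measure (\d_(p : BR)).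
pose dq : {charge set BR -> \bar R} := charge_of_finite_measure (\d_(q : BR)).
pose nu' : {charge set BR -> \bar R} := cadd (cadd nu (cscale t dp)) (cscale (- t) dq).
have E (A : set BR) : (nu' A = nu A + t%:E * \d_(p : BR) A - t%:E * \d_(q : BR) A)%E.
  by rewrite -mulNe -EFinN.
have mo : measurable (`]a, b[ : set BR) by exact: measurable_itv.
have Op : (`]a, b[ : set R) p by rewrite /= in_itv/= ap (lt_trans pq).
have Oq : (`]a, b[ : set R) q by rewrite /= in_itv/= qb (lt_trans ap).
exists nu'; last by move=> A _; exact: E.
split.
  move=> A mA A0; rewrite E off// !diracE.
  rewrite !memNset ?mule0 ?sube0 ?adde0//.
  - by move=> Aq; have : (A `&` `]a, b[) q by []; rewrite A0.
  - by move=> Ap; have : (A `&` `]a, b[) p by []; rewrite A0.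
move=> phi tphi; have [dphi _ _] := tphi.
have cphi : continuous phi by apply: derivable_continuous; exact: (dphi 0).
have mphi : measurable_fun (`]a, b[ : set BR) (phi : BR -> R).
  by apply: measurable_funTS; exact: continuous_measurable_fun.
have [M hM] := continuous_bounded_itv a b _ cphi.
rewrite integral_raise// D//.
have F : charge_integral nu `]a, b[ (EFin \o phi) \is a fin_num.
  exact: (charge_integral_fin_num _ _ _ M).
have [t0|t0] := leP 0 t.
  rewrite (@charge_integral_dirac R nu nu' t p q `]a, b[ phi M)//.
  by rewrite -(fineK F) -!(EFinN, EFinB, EFinD); congr EFin; lra.
(* For negative [t], the mass [- t] is added at [q] and removed at [p]. *)
rewrite (@charge_integral_dirac R nu nu' (- t) q p `]a, b[ phi M)//.
- by rewrite -(fineK F) -!(EFinN, EFinB, EFinD); congr EFin; lra.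
- by rewrite oppr_ge0 ltW.
- move=> A mA; rewrite E !diracE.
  have FA : nu A \is a fin_num by exact: fin_num_measure.
  by rewrite -(fineK FA) -!EFinM -!(EFinN, EFinB, EFinD); congr EFin; lra.
Qed.

End competitor.

(** * Almost everywhere estimates *)

Section almost_everywhere.
Context {R : realType}.
Notation BR := (measurableTypeR R).
Notation mu := (@lebesgue_measure R).

Lemma ae_mono (P Q : R -> Prop) : (forall x, P x -> Q x) ->
  {ae mu, forall x, P x} -> {ae mu, forall x, Q x}.
Proof. by move=> PQ; apply: filterS PQ; exact: (ae_filter_ringOfSetsType mu). Qed.

Lemma ae_and (P Q : R -> Prop) : {ae mu, forall x, P x} ->
  {ae mu, forall x, Q x} -> {ae mu, forall x, P x /\ Q x}.
Proof.
by move=> p q; apply: filterI => //; exact: (ae_filter_ringOfSetsType mu).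
Qed.

(** If the integrals were equal, [g2 - g1], which is nonnegative a.e., would have zero integral and
    so vanish a.e. *)
Lemma ae_lt_integral (D : set BR) (g1 g2 : R -> R) : measurable D ->
  mu.-integrable D (EFin \o g1) -> mu.-integrable D (EFin \o g2) ->
  {ae mu, forall x, D x -> g1 x <= g2 x} ->
  ~ {ae mu, forall x, D x -> g1 x = g2 x} ->
  (\int[mu]_(x in D) (g1 x)%:E < \int[mu]_(x in D) (g2 x)%:E)%E.
Proof.
move=> mD i1 i2 le12 ne12.
have F1 := integrable_fin_num mD i1; have F2 := integrable_fin_num mD i2.
pose k (x : BR) := ((g2 x)%:E - (g1 x)%:E)%E.
have ik : mu.-integrable D k by exact: integrableB.
have mk := measurable_int _ ik.
have kE : (\int[mu]_(x in D) k x = \int[mu]_(x in D) `|k x|)%E.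
  apply: ae_eq_integral => //; first exact: measurableT_comp.
  apply: filterS le12 => x h Dx; rewrite gee0_abs// /k.
  by rewrite sube_ge0// lee_fin; exact: h.
rewrite -sube_gt0 -(integralB_EFin _ i2 i1)// -/k.
rewrite lt_neqAle; apply/andP; split; last first.
  by rewrite [leRHS]kE integral_ge0.
apply/eqP => k0; apply: ne12.
have /(ae_eq_integral_abs mu mD mk) : (\int[mu]_(x in D) `|k x| = 0)%E by rewrite -kE.
apply: filterS => x h Dx; have := h Dx; rewrite /k /= -EFinB => -[] /eqP.
by rewrite subr_eq0 => /eqP.
Qed.

Lemma ae_bounded_integrable (D : set BR) (g : R -> R) (M : R) : measurable D ->
  (mu D < +oo)%E -> measurable_fun D (g : BR -> R) ->
  {ae mu, forall x, D x -> `|g x| <= M} -> mu.-integrable D (EFin \o g).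
Proof.
move=> mD fD mg gM; apply/integrableP; split; first exact/measurable_EFinP.
apply: (@le_lt_trans _ _ (`|M|%:E * mu D)%E).
  apply: integral_le_bound => //; first exact/measurable_EFinP.
  apply: filterS gM => x h Dx; rewrite /= lee_fin (le_trans (h Dx))//.
  exact: ler_norm.
by rewrite lte_mul_pinfty// lee_fin.
Qed.

(** Otherwise an interval of positive length would lie in a null set. *)
Lemma ae_exists_itv (p q : R) (P : R -> Prop) : p < q ->
  {ae mu, forall x, P x} -> exists2 x, p < x < q & P x.
Proof.
move=> pq [N [mN N0 PN]]; apply: contrapT => h.
have sub : `]p, q[ `<=` N.
  move=> x /=; rewrite in_itv/= => pxq; apply: PN => Px; apply: h.
  by exists x.
have mi : measurable (`]p, q[ : set BR) by exact: measurable_itv.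
have : (mu (`]p, q[ : set BR) <= mu N)%E by apply: le_measure; rewrite ?inE.
by rewrite N0 lebesgue_measure_itv/= lte_fin pq -EFinB lee_fin subr_le0 leNgt pq.
Qed.

Lemma ae_lebesgue_pt (a b : R) (v : R -> R) : mu.-integrable `]a, b[ (EFin \o v) ->
  {ae mu, forall x, lebesgue_pt (v \_ `]a, b[) x}.
Proof.
by move=> iv; apply: lebesgue_differentiation; exact: integrable_locally.
Qed.

(** Between any Lebesgue point and a fixed one, [v] varies by at most the total mass of [|Dv|]. The
    bound makes the fidelity integrands integrable, so that a strict comparison of energies is
    possible. *)
Lemma bv_ae_bounded (a b : R) (v : R -> R) : a < b -> bv `]a, b[ v ->
  exists M, {ae mu, forall x, `]a, b[ x -> `|v x| <= M}.
Proof.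
move=> ab [iv [nu Dv]]; have L := ae_lebesgue_pt a b v iv.
have [x0 /andP[ax0 x0b] Lx0] := ae_exists_itv a b _ ab L.
exists (`|v x0| + fine (total_var nu setT)).
move: L; apply: ae_mono => x Lx /=; rewrite in_itv/= => /andP[ax xb].
have B (A : set BR) r : measurable A -> nu A = r%:E -> `|r| <= fine (total_var nu setT).
  move=> mA nA; rewrite -lee_fin fineK ?total_var_fin_num// -abse_EFin -nA.
  apply: le_trans (le_total_var nu _ mA) _.
  by apply: (le_measure (charge_variation (hahnPN nu))); rewrite ?inE.
rewrite -[v x](subrK (v x0)) addrC (le_trans (ler_normD _ _))// lerD2l.
have [xx0|x0x|->] := ltgtP x x0; last 1 first.
- by rewrite subrr normr0 fine_ge0// (measure_ge0 (charge_variation (hahnPN nu))).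
- rewrite distrC; apply: (B `]x, x0[); first exact: measurable_itv.
  exact: (distr_deriv_repr a b).
- apply: (B `]x0, x[); first exact: measurable_itv.
  exact: (distr_deriv_repr a b).
Qed.

(** [v y - v x - c] is the measure under [Dv] of []x, y[] without [x0]. This set lies in a punctured
    neighbourhood of [x0]; such neighbourhoods decrease to the empty set, so their [|Dv|] measure
    tends to 0. *)
Lemma distr_deriv_jump (a b x0 c e : R) (v : R -> R) (nu : {charge set BR -> \bar R}) :
  mu.-integrable `]a, b[ (EFin \o v) -> is_distr_deriv `]a, b[ v nu ->
  nu [set x0] = c%:E -> 0 < e ->
  exists2 d, 0 < d & forall x y, a < x -> y < b -> x0 - d < x -> x < x0 ->
    x0 < y -> y < x0 + d ->
    lebesgue_pt (v \_ `]a, b[) x -> lebesgue_pt (v \_ `]a, b[) y ->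
    `|v y - v x - c| <= e.
Proof.
move=> iv Dv nx e0.
have mX : measurable ([set x0] : set BR) by exact: measurable_set1.
pose F (n : nat) : set BR := `]x0 - n.+1%:R^-1, x0 + n.+1%:R^-1[ `\` [set x0].
have mF n : measurable (F n) by apply: measurableD => //; exact: measurable_itv.
have F0 : \bigcap_n F n = set0.
  apply/seteqP; split => // z Fz.
  have zx : z != x0 by apply/eqP; have [_] := Fz 0 I.
  have z0 : 0 < `|z - x0| by rewrite normr_gt0 subr_eq0.
  have [n _ /(_ n (leqnn n)) hn] := near_infty_natSinv_lt (PosNum z0).
  have [/= + _] := Fz n I; rewrite in_itv/= => /andP[z1 z2].
  have : `|z - x0| < n.+1%:R^-1 by rewrite ltr_distl z1 z2.
  by rewrite ltNge ltW.
have := @nonincreasing_cvg_mu _ BR R (charge_variation (hahnPN nu)) F.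
rewrite F0 measure0 => cF.
have {}cF : (total_var nu (F n) @[n --> \oo] --> 0)%E.
  apply: cF => //.
  - by have := total_var_fin_num nu _ (mF 0); rewrite fin_numElt => /andP[].
  - move=> m n mn; apply/subsetPset => z [/= + zx]; rewrite !in_itv/= => /andP[z1 z2].
    split => //=; rewrite in_itv/=.
    have : n.+1%:R^-1 <= m.+1%:R^-1 :> R by rewrite lef_pV2 ?posrE// ler_nat.
    move=> nm; rewrite (le_lt_trans _ z1) ?lerD2l ?lerN2//=.
    by rewrite (lt_le_trans z2)// lerD2l.
have [n hn] : exists n, (total_var nu (F n) <= e%:E)%E.
  have /fine_cvgP[_ /cvgrPdist_le /(_ e e0)[n _ /(_ n (leqnn n))]] := cF.
  rewrite /= sub0r normrN => h; exists n.
  rewrite -(fineK (total_var_fin_num nu _ (mF n))) lee_fin.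
  exact: le_trans (ler_norm _) h.
exists n.+1%:R^-1 => // x y ax yb x0x xx0 x0y yx0 Lx Ly.
have mi : measurable (`]x, y[ : set BR) by exact: measurable_itv.
have mD : measurable (`]x, y[ `\` [set x0] : set BR) by exact: measurableD.
have R1 := distr_deriv_repr a b v nu x y iv Dv Lx Ly ax (lt_trans xx0 x0y) yb.
have := chargeDI nu mi mX; rewrite R1 setIidr; last first.
  by move=> z /= ->; rewrite in_itv/= xx0.
rewrite nx => R2.
have R3 : nu (`]x, y[ `\` [set x0]) = (v y - v x - c)%:E.
  by rewrite EFinB R2 addeK.
rewrite -lee_fin -abse_EFin -R3; apply: le_trans (le_total_var nu _ mD) _.
apply: le_trans hn; apply: (le_measure (charge_variation (hahnPN nu))); rewrite ?inE//.
move=> z [/=]; rewrite /F /= !in_itv/= => /andP[z1 z2] zx; split => //.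
by rewrite (lt_trans x0x)// (lt_trans z2).
Qed.

End almost_everywhere.

(** * Comparison of energies *)

Section energy.
Context {R : realType}.
Notation BR := (measurableTypeR R).
Notation mu := (@lebesgue_measure R).

Lemma distr_derivP (O : set R) (u : R -> R) : bv O u ->
  is_distr_deriv O u (distr_deriv O u).
Proof.
by move=> [_ h]; rewrite /distr_deriv; case: pselect => // h'; case: cid.
Qed.

Lemma bv_raise (a b p q t : R) (u : R -> R) : a < p -> p < q -> q < b ->
  bv `]a, b[ u -> bv `]a, b[ (raise u t p q).
Proof.
move=> ap pq qb [iu [nu Du]]; split; last first.
  have [nu' Dv _] := is_distr_deriv_raise a b p q t u nu ap pq qb iu Du.
  by exists nu'.
have mo : measurable (`]a, b[ : set BR) by exact: measurable_itv.
have i0 : mu.-integrable `]a, b[ (EFin \o (\1_(`]p, q[ : set R) : R -> R)).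
  exact: (integrableS measurableT mo _ (@integrable_indic_itv R p q false true)).
have := integrableD mo iu (integrableZl mo t i0).
by rewrite /raise /= /comp /=.
Qed.

(** The total variation hypothesis ranges over all charges with the prescribed values because the
    derivative of the competitor is a chosen one, known only through its values on measurable
    sets. *)
Lemma energy_raise_lt (a b p q t eta Mf Mu Mw : R) (f w u : R -> R) :
  a < p -> p < q -> q < b -> bv `]a, b[ u ->
  measurable_fun (`]a, b[ : set BR) (f : BR -> R) ->
  measurable_fun (`]a, b[ : set BR) (w : BR -> R) ->
  {ae mu, forall x, `]a, b[ x -> `|f x| <= Mf} ->
  {ae mu, forall x, `]a, b[ x -> `|u x| <= Mu} ->
  {ae mu, forall x, `]a, b[ x -> `|w x| <= Mw} ->
  {ae mu, forall x, `]a, b[ x -> 0 <= w x} ->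
  ~ {ae mu, forall x, `]p, q[ x -> w x = 0} ->
  t != 0 -> `|t| <= eta ->
  {ae mu, forall x, `]p, q[ x -> `|t| * eta <= t * (f x - u x)} ->
  (forall nu : {charge set BR -> \bar R},
    (forall A : set BR, measurable A -> nu A =
       distr_deriv `]a, b[ u A + t%:E * \d_(p : BR) A - t%:E * \d_(q : BR) A)%E ->
    (total_var nu `]a, b[ <= total_var (distr_deriv `]a, b[ u) `]a, b[)%E) ->
  (energy `]a, b[ f w (raise u t p q) < energy `]a, b[ f w u)%E.
Proof.
move=> ap pq qb bu mf mw fM uM wM w0 wI t0 te gI TV.
have ab : a < b by apply: (lt_trans ap); exact: lt_trans qb.
have mo : measurable (`]a, b[ : set BR) by exact: measurable_itv.
have fo : (mu (`]a, b[ : set BR) < +oo)%E.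
  by rewrite lebesgue_measure_itv/= lte_fin ab -EFinB ltry.
have [iu _] := bu; have Du := distr_derivP _ _ bu.
have bv' := bv_raise a b p q t u ap pq qb bu; set v := raise u t p q in bv' *.
have [iv _] := bv'; have Dv := distr_derivP _ _ bv'.
have mmu : measurable_fun (`]a, b[ : set BR) (u : BR -> R).
  by apply/measurable_EFinP; exact: measurable_int iu.
have mv : measurable_fun (`]a, b[ : set BR) (v : BR -> R).
  by apply/measurable_EFinP; exact: measurable_int iv.
have vM : {ae mu, forall x, `]a, b[ x -> `|v x| <= Mu + `|t|}.
  move: uM; apply: ae_mono => x uMx /uMx {}uMx.
  rewrite /v /raise (le_trans (ler_normD _ _))// lerD// normrM ler_piMr//.
  by rewrite indicE; case: (_ \in _); rewrite ?normr1 ?normr0.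
have TVle : (total_var (distr_deriv `]a, b[ v) `]a, b[ <=
    total_var (distr_deriv `]a, b[ u) `]a, b[)%E.
  apply: TV => A mA.
  have [nu' Dnu' E] := is_distr_deriv_raise a b p q t u _ ap pq qb iu Du.
  by rewrite -E//; exact: distr_deriv_unique Dv Dnu' A mA.
pose G z (x : R) := w x * (f x - z x) ^+ 2.
have iG (z : R -> R) Mz : measurable_fun (`]a, b[ : set BR) (z : BR -> R) ->
    {ae mu, forall x, `]a, b[ x -> `|z x| <= Mz} ->
    mu.-integrable `]a, b[ (EFin \o G z).
  move=> mz zM; apply: (ae_bounded_integrable _ _ (Mw * (Mf + Mz) ^+ 2)) => //.
    apply: measurable_funM => //; apply: measurable_funX.
    exact: measurable_funB.
  move: (ae_and _ _ (ae_and _ _ fM wM) zM); apply: ae_mono => x [[h1 h2] h3] Ox.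
  rewrite normrM normrX ler_pM//; first exact: h2.
  rewrite lerXn2r ?nnegrE//.
    by rewrite (le_trans (normr_ge0 (f x)))// (le_trans (h1 Ox))// lerDl (le_trans _ (h3 Ox)).
  by rewrite (le_trans (ler_normB _ _))// lerD// ?h1 ?h3.
have iGu := iG _ _ mmu uM; have iGv := iG _ _ mv vM.
(* Expanding the squares, the gain is [w] times [2t(f - u) - t^2], and [t^2 <= |t| eta]. *)
have key x : `]p, q[ x -> 0 <= w x -> `|t| * eta <= t * (f x - u x) ->
    w x * (`|t| * eta) <= G u x - G v x.
  move=> Ix wx gx; rewrite /G -mulrBr ler_wpM2l//.
  rewrite /v /raise indicE mem_set// mulr1.
  have : t ^+ 2 <= `|t| * eta by rewrite -real_normK ?num_real// expr2 ler_wpM2l.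
  by move=> h; lra.
have out x : ~ `]p, q[ x -> G v x = G u x.
  by move=> Ix; rewrite /G /v /raise indicE memNset// mulr0 addr0.
have eta0 : 0 < eta by rewrite (lt_le_trans _ te)// normr_gt0.
have lt : (\int[mu]_(x in `]a, b[) (G v x)%:E < \int[mu]_(x in `]a, b[) (G u x)%:E)%E.
  apply: ae_lt_integral => //.
    move: (ae_and _ _ w0 gI); apply: ae_mono => x [h1 h2] Ox.
    have [Ix|Ix] := pselect (`]p, q[ x); last by rewrite out.
    rewrite -subr_ge0 (le_trans _ (key x Ix (h1 Ox) (h2 Ix)))//.
    by rewrite mulr_ge0 ?h1// mulr_ge0// ltW.
  (* If nothing were gained a.e., [key] would force [w <= 0] a.e. on []p, q[]. *)
  apply: contra_not wI => eqG.
  move: (ae_and _ _ eqG (ae_and _ _ w0 gI)); apply: ae_mono => x [h [h1 h2]] Ix.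
  have Ox : `]a, b[ x.
    by move: Ix; rewrite /= !in_itv/= => /andP[s1 s2]; rewrite (lt_trans ap)//= (lt_trans s2).
  have := key x Ix (h1 Ox) (h2 Ix); rewrite h// subrr pmulr_lle0; last first.
    by rewrite mulr_gt0// normr_gt0.
  by move=> w0x; apply/eqP; rewrite eq_le w0x h1.
have Fu := integrable_fin_num mo iGu; have Fv := integrable_fin_num mo iGv.
rewrite /energy; apply: lte_leD => //.
(* Finiteness of the total variation preserves the strict inequality between the fidelity terms. *)
- exact: total_var_fin_num.
- by rewrite lte_pmul2l// lte_fin invr_gt0.
Qed.

End energy.

(** * The inclusion of jump sets *)

Section jump.
Context {R : realType}.
Notation BR := (measurableTypeR R).
Notation mu := (@lebesgue_measure R).
Implicit Type nu : {charge set BR -> \bar R}.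

Lemma total_var_atom_eq0 nu (x : R) :
  total_var nu [set x] = 0%E <-> nu [set x] = 0%E.
Proof.
have mX : measurable ([set x] : set BR) by exact: measurable_set1.
split=> [tv0|nu0].
  have := le_total_var nu _ mX; rewrite tv0 => h; apply/eqP.
  by rewrite -abse_eq0 eq_le h abse_ge0.
rewrite total_varE//; have [Px|Px] := pselect (hahnP nu x).
  rewrite setIidl; last by move=> _ ->.
  rewrite (_ : _ `\` _ = set0) ?charge0 ?nu0 ?subee//.
  by apply/seteqP; split => // z [->].
rewrite (_ : _ `&` _ = set0); last by apply/seteqP; split => // z [->].
rewrite (_ : _ `\` _ = [set x]) ?charge0 ?nu0 ?subee//.
by apply/seteqP; split => [z []//|z ->]; split.
Qed.

Lemma Lfun_infty_ae (O : set R) (w : R -> R) : measurable (O : set BR) ->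
  w \_ O \in Lfun mu +oo%E ->
  measurable_fun (O : set BR) (w : BR -> R) /\
  exists M, {ae mu, forall x, O x -> `|w x| <= M}.
Proof.
move=> mO hw; split.
  have mw : measurable_fun setT (w \_ O : BR -> R) by exact: (set_mem (sub_Lfun_mfun hw)).
  exact: (measurable_restrictT _ mO).2 mw.
have := set_mem (sub_Lfun_finLfun hw); rewrite /= /finite_norm unlock /=.
(* The norm is an essential supremum only if the whole space has positive measure; the line has
   infinite measure. *)
case: ifPn => [_ lty|]; last first.
  by rewrite -set_itvNyy lebesgue_measure_itv/= addye// ltry.
have := ess_sup_ge mu (abse \o (EFin \o (w \_ O))).
move: lty; case: (ess_sup _ _) => [M _ | // | _].
- move=> h; exists M; move: h; apply: ae_mono => x /= + Ox.
  by rewrite patchE mem_set// lee_fin.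
(* An essential supremum [-oo] would bound an absolute value, so any constant serves. *)
- by move=> h; exists 0; move: h; apply: ae_mono => x.
Qed.

(** If [w] vanished a.e. on one side of [x], an interval of positive length, cut off at [a] or [b]
    to stay in the domain, would contain a point where [w] is both zero and positive. *)
Lemma supp_lrT (a b : R) (w : R -> R) :
  {ae mu, forall x, `]a, b[ x -> 0 < w x} -> `]a, b[ `<=` supp_lr `]a, b[ w.
Proof.
move=> w0 x; rewrite /= in_itv/= => /andP[ax xb]; split; first by rewrite /= in_itv/= ax.
move=> e e0; split => h; have hw := ae_and _ _ w0 h.
- have [|y /andP[y1 y2] [h1 h2]] := ae_exists_itv (Num.max a (x - e)) x _ _ hw.
    by rewrite gt_max ax/= ltrBlDr ltrDl.
  move: y1; rewrite gt_max => /andP[y1 y3].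
  have Oy : `]a, b[ y by rewrite /= in_itv/= y1 (lt_trans y2).
  by have := h1 Oy; rewrite h2 ?ltxx//; split => //; rewrite /= in_itv/= y3.
- have [|y /andP[y1 y2] [h1 h2]] := ae_exists_itv x (Num.min b (x + e)) _ _ hw.
    by rewrite lt_min xb/= ltrDl.
  move: y2; rewrite lt_min => /andP[y2 y3].
  have Oy : `]a, b[ y by rewrite /= in_itv/= y2 (lt_trans ax).
  by have := h1 Oy; rewrite h2 ?ltxx//; split => //; rewrite /= in_itv/= y1.
Qed.

Lemma jump_set_supp_lr (a b : R) (f w u : R -> R) : a < b ->
  bv `]a, b[ f -> w \_ `]a, b[ \in Lfun mu +oo%E ->
  {ae mu, forall x, `]a, b[ x -> 0 <= w x} -> is_solution `]a, b[ f w u ->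
  jump_set `]a, b[ u `&` supp_lr `]a, b[ w `<=` jump_set `]a, b[ f.
Proof.
move=> ab hf hw w0 [hu umin] x0 [[Ox0 ju] [_ supp]]; split => // jf.
have mo : measurable (`]a, b[ : set BR) by exact: measurable_itv.
have /andP[ax0 x0b] : a < x0 < b by move: Ox0; rewrite /= in_itv.
have [[iff _] [iu _]] := (hf, hu).
have Df := distr_derivP _ _ hf; have Du := distr_derivP _ _ hu.
set nuf := distr_deriv `]a, b[ f in Df jf; set nu := distr_deriv `]a, b[ u in Du ju.
have mX : measurable ([set x0] : set BR) by exact: measurable_set1.
have /total_var_atom_eq0 nuf0 := jf.
pose c := fine (nu [set x0]).
have nuc : nu [set x0] = c%:E by rewrite fineK//; exact: fin_num_measure.
have c0 : c != 0.
  by apply/eqP => c0; apply: ju; apply/total_var_atom_eq0; rewrite nuc c0.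
have [mw [Mw wM]] := Lfun_infty_ae _ _ mo hw.
have [Mf fM] := bv_ae_bounded _ _ _ ab hf.
have [Mu uM] := bv_ae_bounded _ _ _ ab hu.
have mf : measurable_fun (`]a, b[ : set BR) (f : BR -> R).
  by apply/measurable_EFinP; exact: measurable_int iff.
(* A tolerance of [k / 8] for each of [f] and [u] leaves a drop of at least [3k / 4], which is
   [3 eta] for the [eta] chosen below. *)
pose k := `|c|; have k0 : 0 < k by rewrite normr_gt0.
have e0 : 0 < k / 8 by rewrite divr_gt0.
have [df df0 jumpf] := distr_deriv_jump a b x0 0 (k / 8) f nuf iff Df nuf0 e0.
have [du du0 jumpu] := distr_deriv_jump a b x0 c (k / 8) u nu iu Du nuc e0.
have L := ae_and _ _ (ae_lebesgue_pt _ _ _ iff) (ae_lebesgue_pt _ _ _ iu).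
(* Halving keeps [x0 - d] and [x0 + d] strictly inside []a, b[], as the competitor requires. *)
pose d := Num.min (Num.min df du) (Num.min (x0 - a) (b - x0)) / 2.
have d0 : 0 < d by rewrite divr_gt0// !lt_min df0 du0 !subr_gt0 ax0.
have dd : 2 * d = Num.min (Num.min df du) (Num.min (x0 - a) (b - x0)) by rewrite mulrC divfK.
have d1 : [/\ 2 * d <= df, 2 * d <= du, 2 * d <= x0 - a & 2 * d <= b - x0].
  by rewrite dd; split; rewrite !ge_min lexx ?orbT.
case: d1 => d1 d2 d3 d4.
(* Multiplying by the sign of [c] treats both directions of the jump at once. *)
pose s := Num.sg c.
have sc : s * c = k by rewrite /k normrEsg.
have s1 : `|s| = 1 by rewrite /s normr_sg c0.
pose eta := k / 4; have eta0 : 0 < eta by rewrite divr_gt0.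
(* [s * (f - u)] drops by about [k] across [x0], up to the error [2 * (k / 8)]. *)
have drop x y : x0 - d < x -> x < x0 -> x0 < y -> y < x0 + d ->
   lebesgue_pt (f \_ `]a, b[) x /\ lebesgue_pt (u \_ `]a, b[) x ->
   lebesgue_pt (f \_ `]a, b[) y /\ lebesgue_pt (u \_ `]a, b[) y ->
   s * (f y - u y) <= s * (f x - u x) - 3 * eta.
  move=> x1 x2 y1 y2 [Lfx Lux] [Lfy Luy].
  have jf' : `|f y - f x - 0| <= k / 8 by apply: jumpf => //; lra.
  have ju' : `|u y - u x - c| <= k / 8 by apply: jumpu => //; lra.
  have h1 : `|s * (f y - f x - 0)| <= k / 8 by rewrite normrM s1 mul1r.
  have h2 : `|s * (u y - u x - c)| <= k / 8 by rewrite normrM s1 mul1r.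
  move: h1 h2; rewrite !ler_norml /eta => /andP[_ h1] /andP[h2 _].
  move: h1 h2; rewrite !mulrBr sc; lra.
have tc : (0 <= s * eta <= c) || (c <= s * eta <= 0).
  rewrite /s /eta /k; have [cn|cp|c00] := ltgtP c 0; last by rewrite c00 eqxx in c0.
    by rewrite ltr0_sg// ltr0_norm//; apply/orP; right; apply/andP; split; lra.
  by rewrite gtr0_sg// gtr0_norm//; apply/orP; left; apply/andP; split; lra.
(* A competitor of strictly smaller energy contradicts the minimality of [u]. *)
have absurd p q t : a < p -> p < q -> q < b ->
   ~ {ae mu, forall x, `]p, q[ x -> w x = 0} -> `|t| = eta ->
   {ae mu, forall x, `]p, q[ x -> eta * eta <= t * (f x - u x)} ->
   (forall nu' : {charge set BR -> \bar R}, (forall A : set BR, measurable A ->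
     nu' A = nu A + t%:E * \d_(p : BR) A - t%:E * \d_(q : BR) A)%E ->
     (total_var nu' `]a, b[ <= total_var nu `]a, b[)%E) -> False.
  move=> ap pq qb wI te gI TV.
  have := umin _ (bv_raise a b p q t u ap pq qb hu).
  rewrite leNgt (energy_raise_lt a b p q t eta Mf Mu Mw)//.
  - by rewrite -normr_eq0 te gt_eqF.
  - by rewrite te.
  - by rewrite te.
have [supl supr] := supp d d0.
(* Either [s (f - u)] is at least [eta] at all common Lebesgue points on the left, or a single
   exception there puts it, by [drop], below [- 2 eta] at all those on the right. *)
have [left|/existsNP[x nx]] := pselect (forall x, x0 - d < x -> x < x0 ->
    lebesgue_pt (f \_ `]a, b[) x /\ lebesgue_pt (u \_ `]a, b[) x ->
    eta <= s * (f x - u x)).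
(* Moving [u] by [s * eta] on the left carries the part [s * eta] of the atom from [x0] to
   [x0 - d]. *)
- apply: (absurd (x0 - d) x0 (s * eta)) => //; [lra|lra| | | |].
  + apply: contra_not supl; apply: ae_mono => x h [Ix _]; exact: h.
  + by rewrite normrM s1 mul1r gtr0_norm.
  + move: L; apply: ae_mono => x Lx; rewrite /= in_itv/= => /andP[x1 x2].
    by rewrite [leRHS]mulrAC ler_pM2r//; exact: left.
  + move=> nu' E; apply: (total_var_transfer nu nu' _ x0 (x0 - d) (s * eta) c) => //.
    by rewrite /= in_itv/=; apply/andP; split; lra.
- move/not_implyP: nx => [x1 /not_implyP[x2 /not_implyP[Lx /negP]]].
  rewrite -ltNge => gx.
  (* On the right [u] moves the opposite way, and the same part of the atom goes from [x0] to
     [x0 + d]. *)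
  apply: (absurd x0 (x0 + d) (- (s * eta))) => //; [lra|lra| | | |].
  + apply: contra_not supr; apply: ae_mono => y h [Iy _]; exact: h.
  + by rewrite normrN normrM s1 mul1r gtr0_norm.
  + move: L; apply: ae_mono => y Ly; rewrite /= in_itv/= => /andP[y1 y2].
    have := drop x y x1 x2 y1 y2 Lx Ly => gy.
    rewrite mulNr [X in - X]mulrAC -mulNr ler_pM2r//; lra.
  + move=> nu' E; apply: (total_var_transfer nu nu' _ x0 (x0 + d) (s * eta) c) => //.
      by rewrite /= in_itv/=; apply/andP; split; lra.
    move=> A mA; rewrite E//.
    have FA : nu A \is a fin_num by exact: fin_num_measure.
    by rewrite !diracE -(fineK FA) -!EFinM -!(EFinN, EFinB, EFinD); congr EFin; lra.
Qed.

End jump.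

Theorem proposition6p2 (R : realType) (a b : R) (Omega : set R)
    (f w u : R -> R)
    (hab : a < b) (hOmega : Omega = `]a, b[)
    (hf : bv Omega f)
    (hw : w \_ Omega \in Lfun (@lebesgue_measure R) +oo%E)
    (hw0 : {ae @lebesgue_measure R, forall x, Omega x -> 0 <= w x})
    (hu : is_solution Omega f w u) :
  jump_set Omega u `&` supp_lr Omega w `<=` jump_set Omega f /\
  ({ae @lebesgue_measure R, forall x, Omega x -> 0 < w x} ->
   jump_set Omega u `<=` jump_set Omega f).
Proof.
subst Omega.
have sub := jump_set_supp_lr a b f w u hab hf hw hw0 hu; split => // w0 x jx.
by apply: sub; split => //; apply: supp_lrT w0 _ _; case: jx.
Qed.
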